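(* Let $\lambda(W)=\frac{1}{1+W}$ for $W\ge 0$, and let $\rho_0,\rho_1$ be real constants with $\rho_1>\rho_0\ge 0$. Consider the control system $$\partial_t\rho(t,x)+\partial_x\big(\lambda(W(t))\,\rho(t,x)\big)=0,\qquad W(t)=\int_0^1\rho(t,x)\,dx,\qquad t\ge 0,\ x\in[0,1],$$ with $\rho(t,0)\,\lambda(W(t))=u(t)$ for $t\ge 0$. The minimum time to transfer the state from the equilibrium $\rho(0,x)=\rho_0$, $x\in(0,1]$, to the equilibrium $\rho(T,x)=\rho_1$, $x\in[0,1]$, using influx $u\in L^1([0,\infty),[0,\infty))$, is $$T=1+\frac{\rho_0+\rho_1}{2}.$$ That is, $1+\frac{\rho_0+\rho_1}{2}$ is the minimum of the set of all $T>0$ for which there exists a nonnegative $u\in L^1(0,\infty)$ such that the weak solution $\rho$ with constant initial datum $\rho_0$ and influx $u$ satisfies $\rho(T,\cdot)=\rho_1$.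
   Context: States $\rho(t,\cdot)$ are elements of $L^1(0,1)$, so equalities such as $\rho(T,\cdot)=\rho_1$ are understood almost everywhere in $(0,1)$. The function $\lambda(W)=1/(1+W)$ on $[0,+\infty)$ is extended to all of $\mathbb{R}$ in such a way that the extension, still denoted $\lambda$, lies in $C^1(\mathbb{R};(0,+\infty))$. Weak solution on $[0,T]$, for initial datum $\rho(0,\cdot)=r_0\in L^1(0,1)$ and influx $u\in L^1(0,T)$: a function $\rho\in C^0([0,T];L^1(0,1))$ such that, with $W(t)=\int_0^1\rho(t,x)\,dx$, for every $\tau\in[0,T]$ and every $\varphi\in C^1([0,\tau]\times[0,1])$ satisfying $\varphi(\tau,x)=0$ for all $x\in[0,1]$ and $\varphi(t,1)=0$ for all $t\in[0,\tau]$, one has $$\int_0^{\tau}\int_0^1\rho(t,x)\big(\varphi_t(t,x)+\lambda(W(t))\varphi_x(t,x)\big)\,dx\,dt+\int_0^{\tau}u(t)\varphi(t,0)\,dt+\int_0^1 r_0(x)\varphi(0,x)\,dx=0.$$ For almost everywhere nonnegative $r_0$ and $u$ such a weak solution exists, is unique, and is nonnegative almost everywhere. *)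

(* Defs.v *)
From mathcomp Require Import all_boot all_order all_algebra.
From mathcomp Require Import all_classical all_reals all_analysis.

Set Implicit Arguments.
Unset Strict Implicit.
Unset Printing Implicit Defensive.

Import Order.TTheory GRing.Theory Num.Theory.
Import numFieldTopology.Exports numFieldNormedType.Exports.

Local Open Scope classical_set_scope.
Local Open Scope ring_scope.

Definition velocity_extension (R : realType) (lam : R -> R) : Prop :=
  [/\ forall w : R, derivable lam w 1,
      continuous (derive1 lam),
      forall w : R, 0 < lam w &
      forall w : R, 0 <= w -> lam w = 1 / (1 + w)].

Definition total_mass (R : realType) (rho : R -> R -> R) (t : R) : R :=
  \int[@lebesgue_measure R]_(x in `[0, 1]) rho t x.

(* rho \in C^0([0, T]; L^1(0, 1)), stated for a representative of each state *)
Definition continuous_in_L1 (R : realType) (T : R) (rho : R -> R -> R) : Prop :=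
  (forall t : R, t \in `[0, T] ->
     (@lebesgue_measure R).-integrable `[0, 1] (EFin \o rho t)) /\
  (forall t : R, t \in `[0, T] ->
     \int[@lebesgue_measure R]_(x in `[0, 1]) `|rho s x - rho t x|
       @[s --> within `[0, T] (nbhs t)] --> (0 : R)).

(* phi \in C^1([0, tau] * [0, 1]): phi is differentiable in each variable in
   the open rectangle, and phi and both its partial derivatives (there equal to
   phi_t and phi_x) are continuous up to the boundary of the rectangle. *)
Definition C1_on_rectangle (R : realType) (tau : R)
    (phi phi_t phi_x : R -> R -> R) : Prop :=
  let Q := (`[0, tau] `*` `[0, 1] : set (R * R)) in
  [/\ {within Q, continuous (fun z : R * R => phi z.1 z.2)},
      {within Q, continuous (fun z : R * R => phi_t z.1 z.2)},
      {within Q, continuous (fun z : R * R => phi_x z.1 z.2)} &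
      forall t x : R, t \in `]0, tau[ -> x \in `]0, 1[ ->
        is_derive t 1 (fun s : R => phi s x) (phi_t t x) /\
        is_derive x 1 (fun y : R => phi t y) (phi_x t x)].

(* The space-time integral is iterated, x first, so that it depends only on the
   L^1 class of each state rho t. *)
Definition weak_solution (R : realType) (lam : R -> R) (T : R)
    (r0 u : R -> R) (rho : R -> R -> R) : Prop :=
  continuous_in_L1 T rho /\
  forall (tau : R) (phi phi_t phi_x : R -> R -> R),
    tau \in `[0, T] ->
    C1_on_rectangle tau phi phi_t phi_x ->
    (forall x : R, x \in `[0, 1] -> phi tau x = 0) ->
    (forall t : R, t \in `[0, tau] -> phi t 1 = 0) ->
    \int[@lebesgue_measure R]_(t in `[0, tau])
       (\int[@lebesgue_measure R]_(x in `[0, 1])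
          (rho t x * (phi_t t x + lam (total_mass rho t) * phi_x t x)))
    + \int[@lebesgue_measure R]_(t in `[0, tau]) (u t * phi t 0)
    + \int[@lebesgue_measure R]_(x in `[0, 1]) (r0 x * phi 0 x) = 0.

Definition admissible_influx (R : realType) (u : R -> R) : Prop :=
  (@lebesgue_measure R).-integrable `[0, +oo[ (EFin \o u) /\
  {ae @lebesgue_measure R, forall t : R, t \in `[0, +oo[ -> 0 <= u t}.

Definition transfer_times (R : realType) (lam : R -> R) (rho0 rho1 : R) : set R :=
  [set T : R | 0 < T /\
     exists u : R -> R, admissible_influx u /\
     exists rho : R -> R -> R,
       weak_solution lam T (fun=> rho0) u rho /\
       {ae @lebesgue_measure R, forall x : R, x \in `]0, 1[ -> rho T x = rho1}].

Definition is_minimum (R : realType) (A : set R) (m : R) : Prop :=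
  A m /\ lbound A m.

(* Main.v *)
Require Import Defs.
From mathcomp Require Import all_boot all_order all_algebra.
From mathcomp Require Import all_classical all_reals all_analysis.
From mathcomp Require Import measurable_realfun ring lra.

(** Let X be the distance travelled since time 0 by a particle, so that
X' = lambda(W) and X 0 = 0.  The density is carried along unchanged by
characteristics: at time t the points x > X t still show the initial value
rho0, and the points x < X t show what entered at the time s with
X s = X t - x.

Lower bound.  Suppose that rho1 is reached at time T and put a = X T - 1.  If
a were negative, part of the initial state would still be visible at time T,
against rho0 <> rho1.  So a is nonnegative and what is present at time T
entered after the instant at which X equals a.  At a time t before T, the
interval contains at least the remaining initial matter, of mass
rho0 (1 - X t)^+, and the matter that entered since X was equal to a, which is
still there at time T with density rho1 and has mass rho1 (X t - a)^+.  Other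
matter can only add to the mass, because the influx is nonnegative.  In
particular W is nonnegative, so that X' = 1 / (1 + W), and

  T = int (1 + W) dX >= int_0^(1+a) (1 + rho0 (1-y)^+ + rho1 (y-a)^+) dy
    = 1 + a + (rho0 + rho1) / 2.

This is [transfer_time_ge].  The integral is handled through the primitive Psi
of the last integrand: the derivative of t |-> Psi (X t) is at most 1.

The picture with characteristics has to be extracted from the weak
formulation.  The functions g (x - X t) solve the transport equation, and the
test functions (tau - t) g (x - X t) turn the weak formulation into an identity
that is integrated in time ([transport_duality]).  Comparing it at two times
gives the identity at each time ([pointwise_duality]), and when g tends to the
indicator of a half-line it becomes a formula for the mass of [0, k)
([cumulative_mass]); both facts used above are differences of such masses.

Attainment.  Let the density that enters be rho1.  As long as the front X is in
the interval, W = rho0 + (rho1 - rho0) X, and (1 + W) X' = 1 integrates to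
(1 + rho0) X + (rho1 - rho0) X^2 / 2 = t: the front gets to 1 at time
1 + (rho0 + rho1) / 2.  The two-state profile is a weak solution
([ramp_weak_identity]): integrating phi_t in time and phi_x in space leaves
boundary terms, and those along the front cancel by the substitution that
exchanges the position of the front and its arrival time ([front_flux]). *)

Set Implicit Arguments.
Unset Strict Implicit.
Unset Printing Implicit Defensive.

Import Order.TTheory GRing.Theory Num.Theory.
Import numFieldTopology.Exports numFieldNormedType.Exports.

Local Open Scope classical_set_scope.
Local Open Scope ring_scope.

(** * Continuity on subsets *)

Section continuity_on_subsets.
Context {R : realType}.

Lemma continuous_within_comp (S U V : topologicalType) (A : set S) (B : set U)
    (f : U -> V) (r : S -> U) :
  {within B, continuous f} -> {within A, continuous r} ->
  (forall z, A z -> B (r z)) -> {within A, continuous (f \o r)}.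
Proof.
move=> /subspace_continuousP cf /subspace_continuousP cr Ar.
apply/subspace_continuousP => z Az.
apply: (@cvg_comp _ _ _ r f _ (within B (nbhs (r z)))); last exact: cf (Ar z Az).
move=> P wP.
have rP : within A (nbhs z) (r @^-1` [set y | B y -> P y]) := cr z Az _ wP.
by apply: (@filterS _ (nbhs z) _ _ _ _ rP) => s /= + As => /(_ As); apply; exact: Ar.
Qed.

Lemma continuous_comp_within (S U V : topologicalType) (A : set U)
    (f : U -> V) (r : S -> U) :
  {within A, continuous f} -> continuous r -> (forall z, A (r z)) ->
  continuous (f \o r).
Proof.
move=> cf cr Ar; apply/continuous_subspace_setT.
by apply: (continuous_within_comp cf) => //; exact: continuous_subspaceT.
Qed.

Lemma bounded_within_compact (S : topologicalType) (A : set S) (f : S -> R) :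
  compact A -> {within A, continuous f} ->
  exists C, forall z, A z -> `|f z| <= C.
Proof.
move=> cA cf; have := compact_bounded (continuous_compact cf cA).
move=> [M [_ HM]]; exists (M + 1) => z Az; apply: (HM (M + 1)); first by rewrite ltrDl.
by exists z.
Qed.

(** Clamping extends a function given on a segment or a rectangle to the whole
space while keeping its continuity and its bounds. *)
Definition clamp (a b t : R) := Num.max a (Num.min t b).

Lemma clamp_itv a b t : a <= b -> clamp a b t \in `[a, b].
Proof.
by move=> ab; rewrite in_itv/= /clamp le_max lexx ge_max ab ge_min lexx orbT.
Qed.

Lemma clamp_id a b t : t \in `[a, b] -> clamp a b t = t.
Proof.
by rewrite in_itv/= => /andP[a_t tb]; rewrite /clamp min_l// max_r.
Qed.

Lemma continuous_clamp a b : continuous (clamp a b).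
Proof.
move=> t; apply: (@continuous_max R R (cst a) (fun s => Num.min s b) t).
  exact: cst_continuous.
by apply: (@continuous_min R R id (cst b) t); [exact: cvg_id|exact: cst_continuous].
Qed.

Lemma within_continuous_path (tau a b : R) (f : R * R -> R) (p q : R -> R) :
  {within `[0, tau] `*` `[0, 1], continuous f} ->
  {within `[a, b], continuous p} -> {within `[a, b], continuous q} ->
  (forall t, t \in `[a, b] -> p t \in `[0, tau] /\ q t \in `[0, 1]) ->
  {within `[a, b], continuous (fun t => f (p t, q t))}.
Proof.
move=> cf cp cq pq.
apply: (@continuous_within_comp _ _ _ _ _ _ (fun t : R => (p t, q t)) cf).
  apply/subspace_continuousP => t tab.
  move/subspace_continuousP : cp => /(_ t tab) cp.
  move/subspace_continuousP : cq => /(_ t tab) cq.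
  exact: (@cvg_pair _ _ _ _ (nbhs (p t)) (nbhs (q t)) _ _ _ p q).
by move=> t tab; have [? ?] := pq t tab.
Qed.

Lemma within_continuous_near (a b : R) (f : R -> R) (e : R) : a < b -> 0 < e ->
  {within `[a, b], continuous f} ->
  \forall s \near b^'-, forall t, s <= t -> t <= b -> `|f b - f t| <= e.
Proof.
move=> ab e0 /subspace_continuousP/(_ b).
have bab : `[a, b]%classic b by rewrite /= in_itv/= ltW//=.
move=> /(_ bab)/cvgrPdist_le/(_ _ e0)/nbhs_ballP[d /= d0 dP].
near=> s => t st tb.
have as_ : a <= s by near: s; exact: nbhs_left_ge.
have sd : b - d < s by near: s; apply: nbhs_left_gt; rewrite ltrBlDr ltrDl.
apply: dP; last by rewrite /= in_itv/= tb (le_trans as_).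
by rewrite /ball/= ger0_norm ?subr_ge0//; lra.
Unshelve. all: by end_near. Qed.

End continuity_on_subsets.

(** * Integrals on the line *)

Section integrals.
Context {R : realType}.
Local Notation mu := (@lebesgue_measure R).

Lemma ae_eq_Rintegral (D : set R) (f g : R -> R) : measurable D ->
  measurable_fun D f -> measurable_fun D g ->
  {ae mu, forall x, D x -> f x = g x} ->
  \int[mu]_(x in D) f x = \int[mu]_(x in D) g x.
Proof.
move=> mD mf mg fg; congr fine; apply: ae_eq_integral => //.
- exact/measurable_EFinP.
- exact/measurable_EFinP.
- case: fg => N [mN N0 sub]; exists N; split => //.
  apply: subset_trans sub => x /= fgx h; apply: fgx => Dx.
  by rewrite h.
Qed.

Lemma ae_itv_oo_cc (a b : R) (P : R -> Prop) :
  {ae mu, forall x, x \in `]a, b[ -> P x} ->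
  {ae mu, forall x, x \in `[a, b] -> P x}.
Proof.
move=> aeP.
have nab : mu.-negligible [set a; b].
  exists [set a; b]; split => //; first exact: measurableU.
  by apply: countable_lebesgue_measure0; apply: finite_set_countable.
apply: (negligibleS _ (negligibleU aeP nab)).
move=> x /= nP; have [xa|xa] := eqVneq x a; first by right; left.
have [xb|xb] := eqVneq x b; first by right; right.
left => /= h; apply: nP => xab; apply: h; move: xab.
rewrite !in_itv/= => /andP[ax xb'].
by rewrite !lt_neqAle eq_sym xa ax xb xb'.
Qed.

Lemma measurable_fun_integrable (D : set R) (f : R -> R) :
  mu.-integrable D (EFin \o f) -> measurable_fun D f.
Proof. by case/integrableP => /measurable_EFinP. Qed.

Lemma integrable_normr (D : set R) (f : R -> R) :
  mu.-integrable D (EFin \o f) -> mu.-integrable D (EFin \o (fun x => `|f x|)).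
Proof. exact: integrable_abse. Qed.

Lemma integrable_addr (D : set R) (f g : R -> R) : measurable D ->
  mu.-integrable D (EFin \o f) -> mu.-integrable D (EFin \o g) ->
  mu.-integrable D (EFin \o (fun x => f x + g x)).
Proof.
move=> mD fi gi; rewrite (_ : _ \o _ = (EFin \o f) \+ (EFin \o g))%E//.
exact: integrableD.
Qed.

Lemma integrable_subr (D : set R) (f g : R -> R) : measurable D ->
  mu.-integrable D (EFin \o f) -> mu.-integrable D (EFin \o g) ->
  mu.-integrable D (EFin \o (fun x => f x - g x)).
Proof.
move=> mD fi gi; rewrite (_ : _ \o _ = (EFin \o f) \- (EFin \o g))%E//.
exact: integrableB.
Qed.

Lemma integrable_mull (D : set R) (r : R) (f : R -> R) : measurable D ->
  mu.-integrable D (EFin \o f) -> mu.-integrable D (EFin \o (fun x => r * f x)).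
Proof.
move=> mD fi; rewrite (_ : _ \o _ = (fun x => r%:E * (EFin \o f) x)%E)//.
exact: integrableZl.
Qed.

Lemma integrable_mulr_bounded (D : set R) (C : R) (f g : R -> R) :
  measurable D -> mu.-integrable D (EFin \o f) -> measurable_fun D g ->
  (forall x, D x -> `|g x| <= C) ->
  mu.-integrable D (EFin \o (fun x => f x * g x)).
Proof.
move=> mD fi mg gC; rewrite (_ : _ \o _ = (EFin \o f) \* (EFin \o g))%E//.
apply: integrableMl => //; exists C; split; first exact: num_real.
by move=> y Cy x Dx; apply: le_trans (ltW Cy); exact: gC.
Qed.

Lemma integrable_mulr_bool (D : set R) (f : R -> R) (P : R -> bool) :
  measurable D -> mu.-integrable D (EFin \o f) -> measurable_fun D P ->
  mu.-integrable D (EFin \o (fun x => f x * (P x)%:R)).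
Proof.
move=> mD fi mP; apply: (integrable_mulr_bounded (C := 1)) => //; last first.
  by move=> t _; case: (P t); rewrite ?normr1 ?normr0.
rewrite (_ : (fun _ => _) = fun x => if P x then 1 : R else 0); last first.
  by apply/funext => x; case: (P x).
exact: measurable_fun_if.
Qed.

Lemma measurable_within (a b : R) (f : R -> R) :
  {within `[a, b], continuous f} -> measurable_fun `[a, b] f.
Proof. exact: subspace_continuous_measurable_fun. Qed.

Lemma integrable_within (a b : R) (f : R -> R) :
  {within `[a, b], continuous f} -> mu.-integrable `[a, b] (EFin \o f).
Proof.
by move=> cf; apply: continuous_compact_integrable => //; exact: segment_compact.
Qed.

Lemma integrable_cst_itv (a b : itv_bound R) (s t r : R) :
  [set` Interval a b] `<=` `[s, t] ->
  mu.-integrable [set` Interval a b] (EFin \o (fun _ : R => r)).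
Proof.
move=> sub; apply: (@integrableS _ _ _ mu `[s, t]%classic) => //.
apply: continuous_compact_integrable; first exact: segment_compact.
by apply: continuous_subspaceT; exact: cst_continuous.
Qed.

Lemma Rintegral_cst_itvoc (s t r : R) : s <= t ->
  \int[mu]_(x in `]s, t]) r = r * (t - s).
Proof.
move=> st; rewrite Rintegral_cst//= lebesgue_measure_itv/= lte_fin.
by case: ltgtP st => //= -> _; rewrite subrr.
Qed.

Lemma Rintegral_itv_split (a s t : R) (f : R -> R) : a <= s -> s <= t ->
  mu.-integrable `[a, t] (EFin \o f) ->
  \int[mu]_(x in `[a, t]) f x =
  \int[mu]_(x in `[a, s]) f x + \int[mu]_(x in `]s, t]) f x.
Proof.
move=> as_ st fi.
by rewrite -(Rintegral_itvB fi (x := s)) ?bnd_simp// addrC subrK.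
Qed.

Lemma Rintegral_ltr (k : R) : k <= 1 ->
  \int[mu]_(x in `[0, 1]) (x < k)%R%:R = Num.max 0 k.
Proof.
move=> k1.
have -> : \int[mu]_(x in `[0, 1]) (x < k)%R%:R =
    \int[mu]_(x in `[0, 1]) (((fun=> 1) : R -> R) \_ `]-oo, k[) x.
  apply: eq_Rintegral => x _; rewrite patchE.
  have [xk|kx] := ltP x k; first by rewrite mem_set//= in_itv.
  by rewrite memNset//= in_itv/= ltNge kx.
rewrite -Rintegral_mkcondr.
have -> : `[0, 1] `&` `]-oo, k[ = `[0, k[%classic :> set R.
  apply/seteqP; split=> x /=; rewrite !in_itv/=.
    by move=> [/andP[-> _] ->].
  by move=> /andP[-> xk]; rewrite xk/= (ltW (lt_le_trans xk k1)).
rewrite Rintegral_cst//= lebesgue_measure_itv/= lte_fin mul1r.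
by case: ltP => [k0|k0] //=; rewrite oppr0 addr0.
Qed.

Lemma Rintegral_mulr_le (a b z : R) (f : R -> R) : z <= b ->
  \int[mu]_(x in `[a, b]) (f x * (x <= z)%R%:R) = \int[mu]_(x in `[a, z]) f x.
Proof.
move=> zb.
have -> : \int[mu]_(x in `[a, b]) (f x * (x <= z)%R%:R) =
    \int[mu]_(x in `[a, b]) (f \_ `]-oo, z]) x.
  apply: eq_Rintegral => x _; rewrite patchE.
  have [xz|zx] := leP x z; first by rewrite mem_set/= ?in_itv//= mulr1.
  by rewrite memNset/= ?mulr0// in_itv/= leNgt zx.
rewrite -Rintegral_mkcondr; congr (Rintegral _ _ _).
apply/seteqP; split=> x /=; rewrite !in_itv/=; first by move=> [/andP[-> _] ->].
by move=> /andP[-> xz]; rewrite xz (le_trans xz).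
Qed.

Lemma Rintegral_mulr_ge (a b z : R) (f : R -> R) : a <= z ->
  \int[mu]_(x in `[a, b]) (f x * (z <= x)%R%:R) = \int[mu]_(x in `[z, b]) f x.
Proof.
move=> az.
have -> : \int[mu]_(x in `[a, b]) (f x * (z <= x)%R%:R) =
    \int[mu]_(x in `[a, b]) (f \_ `[z, +oo[) x.
  apply: eq_Rintegral => x _; rewrite patchE.
  have [xz|zx] := leP z x; first by rewrite mem_set/= ?in_itv/= ?andbT// mulr1.
  by rewrite memNset/= ?mulr0// in_itv/= andbT leNgt zx.
rewrite -Rintegral_mkcondr; congr (Rintegral _ _ _).
apply/seteqP; split=> x /=; rewrite !in_itv/= ?andbT.
  by move=> [/andP[_ ->] ->].
by move=> /andP[zx ->]; rewrite zx (le_trans az).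
Qed.

(** The fundamental theorem under the regularity that the slices of a test
function have: differentiability inside, continuity up to the ends. *)
Lemma Rintegral_derivative (f F : R -> R) (a b : R) : a <= b ->
  {within `[a, b], continuous f} -> {within `[a, b], continuous F} ->
  (forall x : R, x \in `]a, b[ -> is_derive x 1 F (f x)) ->
  \int[mu]_(x in `[a, b]) f x = F b - F a.
Proof.
rewrite le_eqVlt => /predU1P[<- _ _ _|ab cf cF dF].
  by rewrite set_itv1 Rintegral_set1 subrr.
have [cF1 cF2 cF3] := (continuous_within_itvP _ ab).1 cF.
rewrite /Rintegral (@continuous_FTC2 _ f F) ?EFinB//.
  by split => // x /dF dx; exact: ex_derive.
by move=> x /dF dx; rewrite derive1E derive_val.
Qed.

(** Integrating from -1 makes X differentiable at 0 too, hence continuous on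
segments that start at 0. *)
Lemma antiderivative (v : R -> R) : continuous v ->
  exists2 X : R -> R, X 0 = 0 & forall t : R, -1 < t -> is_derive t 1 X (v t).
Proof.
move=> cv; pose F (x : R) := \int[mu]_(t in `[-1, x]) v t.
exists (fun x => F x - F 0); first by rewrite subrr.
move=> t t1.
have [dF F'] : derivable F t 1 /\ derive1 F t = v t.
  apply: (@continuous_FTC1_closed _ v (-1) t (t + 1)) => //.
    by rewrite ltrDl.
  apply: continuous_compact_integrable; first exact: segment_compact.
    exact: continuous_subspaceT.
  exact: cv.
move: F'; rewrite derive1E => F'.
have : is_derive t 1 F (v t) by rewrite -F'; exact: derivableP.
move=> ?; rewrite (_ : (fun _ => _) = F - cst (F 0))//.
by rewrite -[v t]subr0; apply: is_deriveB.
Qed.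

(** Dominated convergence in the shape in which smooth cut-offs h n are removed:
the bound is |f|, whatever the cut-offs. *)
Lemma cvg_Rintegral_mulr (D : set R) (f : R -> R) (h : nat -> R -> R)
    (h' : R -> R) :
  measurable D -> mu.-integrable D (EFin \o f) ->
  (forall n, measurable_fun D (h n)) ->
  (forall n x, D x -> `|h n x| <= 1) ->
  (forall x, D x -> h n x @[n --> \oo] --> h' x) ->
  \int[mu]_(x in D) (f x * h n x) @[n --> \oo] -->
  \int[mu]_(x in D) (f x * h' x).
Proof.
move=> mD fi mh h1 hh'.
have mf : measurable_fun D f by have /integrableP[/measurable_EFinP] := fi.
have mh' : measurable_fun D h' by exact: measurable_fun_cvg hh'.
apply: fine_cvg.
have [|||||i' _ cv] := @dominated_convergence _ _ _ mu D mD
  (fun n x => (f x * h n x)%:E) (fun x => (f x * h' x)%:E)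
  (fun x => `|(f x)%:E|)%E.
- by move=> n; apply/measurable_EFinP; apply: measurable_funM => //; exact: mh.
- by apply/measurable_EFinP; apply: measurable_funM.
- apply: aeW => x Dx; apply: cvg_EFin; first exact: nearW.
  by apply: cvgM; [exact: cvg_cst|exact: hh'].
- exact: integrable_abse.
- apply: aeW => x n Dx; rewrite /= lee_fin normrM ler_piMr//; exact: h1.
by rewrite fineK// integrable_fin_num.
Qed.

(** If the mean of M over (s, tau) lies between J s and J tau, both ends tend to
J tau as s tends to tau, while the mean tends to M tau. *)
Lemma left_average_squeeze (tau : R) (M J : R -> R) : 0 < tau ->
  {within `[0, tau], continuous M} -> {within `[0, tau], continuous J} ->
  (forall s, 0 <= s -> s < tau ->
    (tau - s) * J s <= \int[mu]_(x in `]s, tau]) M x <= (tau - s) * J tau) ->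
  M tau = J tau.
Proof.
move=> tau0 cM cJ H; apply/eqP; rewrite -subr_eq0 -normr_le0.
apply/ler_addgt0Pl => e e0; rewrite addr0.
have e20 : 0 < e / 2 by rewrite divr_gt0.
near (tau^'-) => s.
have hM : forall t, s <= t -> t <= tau -> `|M tau - M t| <= e / 2.
  by near: s; exact: within_continuous_near cM.
have hJ : forall t, s <= t -> t <= tau -> `|J tau - J t| <= e / 2.
  by near: s; exact: within_continuous_near cJ.
have s0 : 0 <= s by near: s; exact: nbhs_left_ge.
have st : s < tau by near: s; exact: nbhs_left_lt.
have {H} /andP[H1 H2] := H _ s0 st.
have st0 : 0 < tau - s by rewrite subr_gt0.
have sub : `]s, tau] `<=` (`[0, tau] : set R).
  by apply: subset_itvr; rewrite bnd_simp.
have iM : mu.-integrable `]s, tau] (EFin \o M).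
  apply: (@integrableS _ _ _ mu `[0, tau]%classic) => //.
  by apply: continuous_compact_integrable => //; exact: segment_compact.
have up : \int[mu]_(x in `]s, tau]) M x <= (M tau + e / 2) * (tau - s).
  rewrite -Rintegral_cst_itvoc ?(ltW st)//; apply: le_Rintegral => //.
    exact: (integrable_cst_itv _ sub).
  move=> x; rewrite /= in_itv/= => /andP[/ltW sx xt].
  by have := hM _ sx xt; rewrite ler_distlC => /andP[? ?]; lra.
have lo : (M tau - e / 2) * (tau - s) <= \int[mu]_(x in `]s, tau]) M x.
  rewrite -Rintegral_cst_itvoc ?(ltW st)//; apply: le_Rintegral => //.
    exact: (integrable_cst_itv _ sub).
  move=> x; rewrite /= in_itv/= => /andP[/ltW sx xt].
  by have := hM _ sx xt; rewrite ler_distlC => /andP[? ?]; lra.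
have h1 : J s <= M tau + e / 2.
  by rewrite -(ler_pM2l st0) (le_trans H1)// mulrC.
have h2 : M tau - e / 2 <= J tau.
  by rewrite -(ler_pM2l st0) (le_trans _ H2)// mulrC.
have := hJ s (lexx _) (ltW st); rewrite !ler_norml => /andP[? ?].
by apply/andP; split; lra.
Unshelve. all: by end_near. Qed.

(** The middle term is the increment between s and tau of the second primitive
of w, whose derivative is the first primitive of w; that derivative is
monotone because w is nonnegative, hence the two bounds. *)
Lemma weighted_integral_bounds (tau s : R) (w : R -> R) : 0 <= s -> s <= tau ->
  mu.-integrable `[0, tau] (EFin \o w) -> (forall t, 0 <= w t) ->
  (tau - s) * \int[mu]_(t in `[0, s]) w t <=
  \int[mu]_(t in `[0, tau]) (w t * (tau - t)) -
    \int[mu]_(t in `[0, s]) (w t * (s - t)) <=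
  (tau - s) * \int[mu]_(t in `[0, tau]) w t.
Proof.
move=> s0 st wi w0.
have sub1 : `[0, s] `<=` (`[0, tau] : set R).
  by apply: subset_itvl; rewrite bnd_simp.
have sub2 : `]s, tau] `<=` (`[0, tau] : set R).
  by apply: subset_itvr; rewrite bnd_simp.
have wir r : mu.-integrable `[0, tau] (EFin \o (fun t => w t * (r - t))).
  apply: (integrable_mulr_bounded (C := `|r| + tau)) => //.
    apply: measurable_funB; first exact: measurable_cst.
    exact: measurable_id.
  move=> x; rewrite /= in_itv/= => /andP[x0 xt].
  by rewrite (le_trans (ler_normB _ _))// lerD2l ger0_norm.
have wi1 : mu.-integrable `[0, s] (EFin \o w) by exact: integrableS wi.
have wi2 : mu.-integrable `]s, tau] (EFin \o w) by exact: integrableS wi.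
rewrite !(Rintegral_itv_split s0 st)//.
have -> : \int[mu]_(t in `[0, s]) (w t * (tau - t)) =
    \int[mu]_(t in `[0, s]) (w t * (s - t)) +
    (tau - s) * \int[mu]_(t in `[0, s]) w t.
  rewrite -RintegralZl// -RintegralD//; last 2 first.
    exact: integrableS (wir s).
    exact: integrable_mull.
  by apply: eq_Rintegral => x _; ring.
have lo : 0 <= \int[mu]_(x in `]s, tau]) (w x * (tau - x)).
  apply: Rintegral_ge0 => x; rewrite /= in_itv/= => /andP[sx xt].
  by rewrite mulr_ge0// subr_ge0.
have up : \int[mu]_(x in `]s, tau]) (w x * (tau - x)) <=
    (tau - s) * \int[mu]_(x in `]s, tau]) w x.
  rewrite -RintegralZl//; apply: le_Rintegral => //.
  - exact: integrableS (wir tau).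
  - exact: integrable_mull.
  - move=> x; rewrite /= in_itv/= => /andP[sx xt].
    by rewrite mulrC ler_wpM2r// lerB// ltW.
have cancel (b d e : R) : b + d + e - b = d + e by ring.
by rewrite cancel mulrDr lerDl lo lerD2l.
Qed.

End integrals.

(** * Integration over a rectangle *)

Section rectangle.
Context {R : realType}.
Local Notation mu := (@lebesgue_measure R).

(** Rational boxes form a countable base of the plane, so open sets belong to
the product sigma-algebra. *)
Lemma continuous_measurable_prod (f : R * R -> R) :
  continuous f -> measurable_fun setT f.
Proof.
move=> cf; apply: (measurability _ (RGenOpens.measurableE R)).
move=> _ [_ [a [b ->] <-]]; rewrite setTI.
set O := _ @^-1` _.
have oO : open O by apply: open_comp => //; exact: interval_open.
pose box (p q r s : rat) : set (R * R) :=
  `]ratr p, ratr q[%classic `*` `]ratr r, ratr s[%classic.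
pose U p q r s : set (R * R) :=
  [set z | box p q r s `<=` O /\ box p q r s z].
have -> : O = \bigcup_p \bigcup_q \bigcup_r \bigcup_s U p q r s.
  apply/seteqP; split => [[x y] Oxy|z [p _ [q _ [r _ [s _]]]]]; last first.
    by case=> sub /sub.
  have /nbhs_ballP[e /= e0 eO] : nbhs (x, y) O by exact: open_nbhs_nbhs.
  have rl (z : R) : exists p : rat, z - e < ratr p /\ ratr p < z.
    have /rat_in_itvoo[p] : z - e < z by rewrite ltrBlDr ltrDl.
    by rewrite in_itv/= => /andP[? ?]; exists p.
  have rr (z : R) : exists p : rat, z < ratr p /\ ratr p < z + e.
    have /rat_in_itvoo[p] : z < z + e by rewrite ltrDl.
    by rewrite in_itv/= => /andP[? ?]; exists p.
  have [p [p1 p2]] := rl x; have [q [q1 q2]] := rr x.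
  have [r [r1 r2]] := rl y; have [s [s1 s2]] := rr y.
  exists p => //; exists q => //; exists r => //; exists s => //.
  split; last by split; rewrite /= in_itv/=; apply/andP.
  move=> [x' y'] []/=; rewrite !in_itv/= => /andP[? ?] /andP[? ?].
  apply: eO; split => /=; rewrite /ball/= ltr_norml; apply/andP; split; lra.
apply: bigcupT_measurable_rat => p; apply: bigcupT_measurable_rat => q.
apply: bigcupT_measurable_rat => r; apply: bigcupT_measurable_rat => s.
have [sub|nsub] := pselect (box p q r s `<=` O).
  rewrite (_ : U p q r s = box p q r s); first exact: measurableX.
  by apply/seteqP; split => z [].
by rewrite (_ : U p q r s = set0)//; apply/seteqP; split => z [].
Qed.

Section fubini.
Variables (a b : R) (h : R * R -> R) (C : R).
Hypothesis mh : measurable_fun setT h.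
Hypothesis hC : forall z, `|h z| <= C.

Let A : set R := `[0, a].
Let B : set R := `[0, b].

Let mrow t : measurable_fun setT (fun x => h (t, x)).
Proof. exact: (measurableT_comp mh (measurable_pair1 t)). Qed.

Let mcol x : measurable_fun setT (fun t => h (t, x)).
Proof. exact: (measurableT_comp mh (measurable_pair2 x)). Qed.

Let int_itv (c : R) (f : R -> R) : measurable_fun setT f ->
  (forall x, `|f x| <= C) -> mu.-integrable `[0, c] (EFin \o f).
Proof.
move=> mf fC.
have := @integrable_mulr_bounded _ `[0, c]%classic C (fun=> 1) f.
rewrite (_ : (fun x => 1 * f x) = f); last by apply/funext => x; rewrite mul1r.
apply => //; last exact: measurable_funTS.
exact: (@integrable_cst_itv _ _ _ 0 c).
Qed.

(* Extending h by zero turns integrals over the rectangle into integrals over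
   the plane, to which the theorem of Fubini applies. *)
Let f (z : R * R) : \bar R := (h z * \1_A z.1 * \1_B z.2)%:E.

Let int_f : (mu \x mu)%E.-integrable setT f.
Proof.
have mAB : measurable (A `*` B) by apply: measurableX; exact: measurable_itv.
rewrite (_ : f = (EFin \o h) \_ (A `*` B)).
  have [K _] := @integrable_mkcond _ _ _ (mu \x mu)%E (A `*` B) (EFin \o h) mAB.
  apply: K.
  apply: measurable_bounded_integrable => //.
  - rewrite [X in (X < _)%E](_ : _ = (mu A * mu B)%E); last first.
      by apply: product_measure1E; exact: measurable_itv.
    rewrite /A /B !lebesgue_measure_itv/=.
    by do 2 case: ifPn; rewrite ?mule0 ?mul0e// ltry.
  - exact: measurable_funTS.
  - exists C; split; first exact: num_real.
    by move=> y Cy z _; apply: le_trans (ltW Cy); exact: hC.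
apply/funext => -[t x]; rewrite /f patchE !indicE/= in_setX/=.
by case: (t \in A); case: (x \in B); rewrite ?mulr1 ?mulr0.
Qed.

Let restrictE (D : set R) (g : R -> R) :
  (fun t => (g t * \1_D t)%:E) = (EFin \o g) \_ D.
Proof.
apply/funext => t; rewrite patchE indicE/=.
by case: (t \in D); rewrite ?mulr1 ?mulr0.
Qed.

Let row_f (t : R) : (\int[mu]_x f (t, x))%E =
  ((\int[mu]_(x in B) h (t, x)) * \1_A t)%:E.
Proof.
have mB : measurable B by exact: measurable_itv.
have ih : mu.-integrable B (EFin \o (fun x => h (t, x) * \1_A t)).
  apply: (@integrable_mulr_bounded _ _ 1 (fun x => h (t, x)) (fun=> \1_A t)) => //.
    exact: int_itv.
  by move=> x _; rewrite indicE; case: (_ \in _); rewrite ?normr1 ?normr0.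
rewrite (_ : (fun x => f (t, x)) = (EFin \o (fun x => h (t, x) * \1_A t)) \_ B).
  rewrite -integral_mkcond -RintegralZr//; last exact: int_itv.
  by rewrite fineK//; exact: integrable_fin_num.
by rewrite -restrictE.
Qed.

Let col_f (x : R) : (\int[mu]_t f (t, x))%E =
  ((\int[mu]_(t in A) h (t, x)) * \1_B x)%:E.
Proof.
have mA : measurable A by exact: measurable_itv.
have ih : mu.-integrable A (EFin \o (fun t => h (t, x) * \1_B x)).
  apply: (@integrable_mulr_bounded _ _ 1 (fun t => h (t, x)) (fun=> \1_B x)) => //.
    exact: int_itv.
  by move=> t _; rewrite indicE; case: (_ \in _); rewrite ?normr1 ?normr0.
rewrite (_ : (fun t => f (t, x)) = (EFin \o (fun t => h (t, x) * \1_B x)) \_ A).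
  rewrite -integral_mkcond -RintegralZr//; last exact: int_itv.
  by rewrite fineK//; exact: integrable_fin_num.
by rewrite -restrictE; apply/funext => t; rewrite /f mulrAC.
Qed.

Lemma integrable_row_integral :
  mu.-integrable A (EFin \o (fun t => \int[mu]_(x in B) h (t, x))).
Proof.
have mA : measurable A by exact: measurable_itv.
have [_] := @integrable_mkcond _ _ _ mu A
  (EFin \o (fun t => \int[mu]_(x in B) h (t, x))) mA; apply.
rewrite -restrictE.
rewrite -(funext row_f); exact: (integrable_fubini_F int_f).
Qed.

Lemma measurable_col_integral :
  measurable_fun B (fun x => \int[mu]_(t in A) h (t, x)).
Proof.
have mB : measurable B by exact: measurable_itv.
apply/measurable_EFinP.
have [_] := measurable_restrictT
  (EFin \o (fun x => \int[mu]_(t in A) h (t, x))) mB; apply.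
rewrite -restrictE.
rewrite -(funext col_f); exact: (measurable_fubini_G int_f).
Qed.

Lemma fubini_rectangle :
  \int[mu]_(t in A) (\int[mu]_(x in B) h (t, x)) =
  \int[mu]_(x in B) (\int[mu]_(t in A) h (t, x)).
Proof.
have := Fubini int_f; rewrite (funext row_f) (funext col_f) !restrictE.
by rewrite -!integral_mkcond => /(congr1 fine).
Qed.
End fubini.

End rectangle.

(** * Smooth cut-offs *)

Section cutoffs.
Context {R : realType}.

Lemma is_derive_quadratic (f : R -> R) (s d : R) :
  (forall h, `|f (s + h) - f s - d * h| <= h ^+ 2) -> is_derive s 1 f d.
Proof.
move=> fh.
suff cv : h^-1 *: (f (h *: 1 + s) - f s) @[h --> 0^'] --> d.
  apply: DeriveDef; first by apply/cvg_ex; exists d.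
  exact/cvg_lim.
apply/cvgrPdist_le => e e0; near=> h.
have h0 : h != 0 by near: h; exact: nbhs_dnbhs_neq.
have he : `|h| <= e by near: h; apply: dnbhs0_le.
rewrite distrC (_ : _ - d = h^-1 * (f (s + h) - f s - d * h)); last first.
  by rewrite /GRing.scale/= mulr1 (addrC h); field.
rewrite normrM normfV ler_pdivrMl ?normr_gt0//.
apply: le_trans (fh h) _; rewrite -real_normK ?num_real// expr2.
by rewrite ler_wpM2l.
Unshelve. all: by end_near. Qed.

(** The square of the positive part is continuously differentiable, with twice
the positive part as derivative.  It smooths the indicator of a half-line, and
it is the primitive of the terms (1 - y)^+ and (y - a)^+ of the lower bound. *)
Definition possq (s : R) := (Num.max 0 s) ^+ 2.

Lemma is_derive_possq (s : R) : is_derive s 1 possq (2 * Num.max 0 s).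
Proof.
apply: is_derive_quadratic => h; rewrite /possq.
rewrite ler_norml; apply/andP; split;
  case: (leP 0 s) => s0; case: (leP 0 (s + h)) => sh0; nra.
Qed.

Lemma possq_ge0 (s : R) : 0 <= possq s. Proof. exact: sqr_ge0. Qed.

Lemma possq_gt0 (s : R) : 0 < s -> 0 < possq s.
Proof. by move=> s0; rewrite /possq max_r ?ltW// exprn_gt0. Qed.

Lemma possq_eq0 (s : R) : s <= 0 -> possq s = 0.
Proof. by move=> s0; rewrite /possq max_l// expr0n. Qed.

(** As e tends to 0 this tends to the indicator of y < k.  It vanishes for
k <= y exactly and not just approximately, since test functions have to vanish
on the outflow boundary. *)
Definition smooth_step (k e y : R) := 1 - e / (e + possq (k - y)).

Definition dsmooth_step (k e y : R) :=
  - (2 * Num.max 0 (k - y)) * (e / (e + possq (k - y)) ^+ 2).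

Let den_gt0 (k e y : R) : 0 < e -> 0 < e + possq (k - y).
Proof. by move=> e0; rewrite ltr_wpDr ?possq_ge0. Qed.

Lemma is_derive_smooth_step (k e y : R) : 0 < e ->
  is_derive y 1 (smooth_step k e) (dsmooth_step k e y).
Proof.
move=> e0; set z := k - y.
have d1 : is_derive y 1 (cst k - id) (0 - 1) by exact: is_deriveB.
have dz := is_derive_possq z.
have d2 : is_derive y 1 (possq \o (cst k - id)) (2 * Num.max 0 z * (0 - 1)).
  exact: is_derive1_comp.
have d3 : is_derive y 1 (cst e + (possq \o (cst k - id)))
    (0 + 2 * Num.max 0 z * (0 - 1)) by exact: is_deriveD.
have dn : (cst e + (possq \o (cst k - id))) y != 0.
  exact: (lt0r_neq0 (den_gt0 k y e0)).
have d4 := is_deriveV dn d3.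
have d5 := is_deriveB (is_derive_cst (1 : R) y 1)
  (is_deriveM (is_derive_cst e y 1) d4).
apply: (is_derive_eq d5).
rewrite /dsmooth_step /GRing.scale/= !fctE -/z; field.
exact: (lt0r_neq0 (den_gt0 k y e0)).
Qed.

Lemma continuous_dsmooth_step (k e : R) : 0 < e -> continuous (dsmooth_step k e).
Proof.
move=> e0 y.
have cm : {for y, continuous (fun y : R => Num.max 0 (k - y))}.
  apply: (@continuous_max R R (cst 0) (fun y : R => k - y) y).
    exact: cst_continuous.
  by apply: continuousB; [exact: cst_continuous|exact: cvg_id].
apply: cvgM; first by apply: cvgN; apply: cvgM => //; exact: cvg_cst.
apply: cvgM; first exact: cvg_cst.
apply: cvgV; first by rewrite expf_neq0// lt0r_neq0// den_gt0.
by apply: cvgM; (apply: cvgD; [exact: cvg_cst|exact: cvgM]).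
Qed.

Lemma smooth_step_itv (k e y : R) : 0 < e -> 0 <= smooth_step k e y <= 1.
Proof.
move=> e0; have d0 := den_gt0 k y e0; rewrite /smooth_step subr_ge0 gerBl.
by rewrite ler_pdivrMr// mul1r lerDl possq_ge0 divr_ge0// ltW.
Qed.

Lemma smooth_step_eq0 (k e y : R) : 0 < e -> k <= y -> smooth_step k e y = 0.
Proof.
move=> e0 ky; rewrite /smooth_step possq_eq0 ?subr_le0// addr0 divff ?subrr//.
exact: lt0r_neq0.
Qed.

Lemma cvg_smooth_step (k y : R) :
  smooth_step k n.+1%:R^-1 y @[n --> \oo] --> ((y < k)%R%:R : R).
Proof.
have ceps : (n.+1%:R^-1 : R) @[n --> \oo] --> (0 : R) by exact: cvg_harmonic.
have [yk|ky] := ltP y k; last first.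
  rewrite (_ : (fun _ => _) = cst 0); first exact: cvg_cst.
  by apply/funext => n; rewrite smooth_step_eq0// invr_gt0.
have p0 : 0 < possq (k - y) by rewrite possq_gt0// subr_gt0.
rewrite (_ : (true%:R : R) = 1 - 0 / (0 + possq (k - y)));
  last by rewrite mul0r subr0.
apply: cvgB; first exact: cvg_cst.
apply: cvgM => //; apply: cvgV; first by rewrite add0r lt0r_neq0.
by apply: cvgD => //; exact: cvg_cst.
Qed.

End cutoffs.

(** * Transport along characteristics *)

Section L1_curves.
Context {R : realType}.
Local Notation mu := (@lebesgue_measure R).

Lemma continuous_total_mass T (rho : R -> R -> R) : continuous_in_L1 T rho ->
  {within `[0, T], continuous (total_mass rho)}.
Proof.
move=> [irho crho]; apply/subspace_continuousP => t /= tT.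
apply/cvgrPdist_le => e e0.
have /cvgrPdist_le/(_ _ e0) := crho _ tT.
move=> h; near=> s.
have sT : s \in `[0, T] by near: s; exact: withinT.
have : `|0 - \int[mu]_(x in `[0, 1]) `|rho s x - rho t x| | <= e.
  by near: s.
apply: le_trans; rewrite distrC /total_mass -RintegralB//; try exact: irho.
rewrite sub0r normrN.
apply: le_trans (ler_norm _); apply: le_normr_Rintegral => //.
by apply: integrable_subr => //; exact: irho.
Unshelve. all: by end_near. Qed.

(** Between the times t and s, the change of rho is controlled in L^1 because the
weight g is bounded, and the change of the weight, with rho t kept fixed, by
dominated convergence. *)
Lemma continuous_moving_average T (rho : R -> R -> R) (g X : R -> R) :
  continuous_in_L1 T rho -> continuous g -> (forall y, `|g y| <= 1) ->
  (forall t : R, t \in `[0, T] -> {for t, continuous X}) ->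
  {within `[0, T], continuous
     (fun t => \int[mu]_(x in `[0, 1]) (rho t x * g (x - X t)))}.
Proof.
move=> [irho crho] cg g1 cX; apply/subspace_continuousP => t /= tT.
have mg (s : R) : measurable_fun (`[0, 1] : set R) (fun x => g (x - X s)).
  apply: measurable_funTS; apply: continuous_measurable_fun => x.
  apply: continuous_comp; last exact: cg.
  by apply: continuousB; [exact: cvg_id|exact: cst_continuous].
pose K (s : R) := \int[mu]_(x in `[0, 1]) (rho t x * g (x - X s)).
have cK : {for t, continuous K}.
  apply/(@cvg_nbhsP _ R^o) => s st; apply: cvg_Rintegral_mulr => //.
  - exact: irho.
  - by move=> x _; apply: (@cvg_comp _ _ _ (fun n => x - X (s n)) g _ (nbhs (x - X t)));
      last exact: cg;
      apply: cvgB; [exact: cvg_cst|exact: (cvg_comp _ _ st (cX _ tT))].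
pose N (s : R) := \int[mu]_(x in `[0, 1]) (rho s x * g (x - X s)).
change (N s @[s --> within `[0, T] (nbhs (t : R))] --> N t).
rewrite (_ : N = (N - K) + K); last by apply/funext => s; rewrite !fctE subrK.
have -> : (N - K + K) t = 0 + K t by rewrite !fctE subrr.
apply: cvgD; last by apply: cvg_within_filter; exact: cK.
apply/cvgrPdist_le => e e0.
have /cvgrPdist_le/(_ _ e0) := crho _ tT.
move=> h; near=> s.
have sT : s \in `[0, T] by near: s; exact: withinT.
have : `|0 - \int[mu]_(x in `[0, 1]) `|rho s x - rho t x| | <= e.
  by near: s.
apply: le_trans; rewrite !sub0r !normrN.
apply: le_trans (ler_norm _).
have ii r : r \in `[0, T] ->
    mu.-integrable `[0, 1] (EFin \o (fun x => rho r x * g (x - X s))).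
  by move=> rT; apply: (integrable_mulr_bounded (C := 1)) => //; exact: irho.
have id : mu.-integrable `[0, 1] (EFin \o (fun x => rho s x - rho t x)).
  by apply: integrable_subr => //; exact: irho.
rewrite !fctE /N /K -RintegralB//; [|exact: ii|exact: ii].
apply: le_trans.
  apply: le_normr_Rintegral => //.
  by apply: integrable_subr => //; exact: ii.
apply: le_Rintegral => //.
- by apply: integrable_normr; apply: integrable_subr => //; exact: ii.
- exact: integrable_normr.
- by move=> x _; rewrite -mulrBl normrM ler_piMr.
Unshelve. all: by end_near. Qed.

End L1_curves.

Section curve.
Context {R : realType}.
Variables v X : R -> R.
Hypothesis v0 : forall t, 0 < v t.
Hypothesis dX : forall t : R, -1 < t -> is_derive t 1 X (v t).

Lemma curve_continuous (t : R) : 0 <= t -> {for t, continuous X}.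
Proof.
move=> t0; have dXt : is_derive t 1 X (v t).
  by apply: dX; rewrite (lt_le_trans _ t0)// ltrN10.
by apply: differentiable_continuous; apply/derivable1_diffP; exact: ex_derive.
Qed.

Lemma curve_within_continuous (a b : R) : 0 <= a ->
  {within `[a, b], continuous X}.
Proof.
move=> a0; apply: continuous_in_subspaceT => t; rewrite inE/= in_itv/=.
by move=> /andP[at_ _]; apply: curve_continuous; exact: le_trans at_.
Qed.

Lemma curve_lt (s t : R) : 0 <= s -> s < t -> X s < X t.
Proof.
move=> s0 st; rewrite -subr_gt0.
have [z|z|z _ ->] := @MVT R X v s t st.
- rewrite in_itv/= => /andP[sz _]; apply: dX.
  by rewrite (lt_trans _ sz)// (lt_le_trans _ s0)// ltrN10.
- exact: curve_within_continuous.
- by rewrite mulr_gt0// subr_gt0.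
Qed.

Lemma curve_le (s t : R) : 0 <= s -> s <= t -> X s <= X t.
Proof. by move=> s0; rewrite le_eqVlt => /predU1P[->//|st]; exact/ltW/curve_lt. Qed.

End curve.

Section characteristics.
Context {R : realType}.
Local Notation mu := (@lebesgue_measure R).
Variables (lam : R -> R) (T c : R) (u : R -> R) (rho : R -> R -> R).
Hypothesis hw : weak_solution lam T (fun=> c) u rho.
Hypothesis ui : mu.-integrable `[0, T] (EFin \o u).
Hypothesis u0 : forall t, 0 <= u t.
Variables (v X : R -> R).
Hypothesis cv : continuous v.
Hypothesis v0 : forall t, 0 < v t.
Hypothesis vE : forall t, t \in `[0, T] -> v t = lam (total_mass rho t).
Hypothesis X0 : X 0 = 0.
Hypothesis dX : forall t : R, -1 < t -> is_derive t 1 X (v t).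

Let cX (t : R) : 0 <= t -> {for t, continuous X}.
Proof. by move=> t0; exact: (curve_continuous dX t0). Qed.

Let leX (s t : R) : 0 <= s -> s <= t -> X s <= X t.
Proof. exact: (curve_le v0 dX). Qed.

(** The weak formulation is tested with (tau - t) g (x - X t).  The transport
operator kills the second factor, so what is left in the space-time integral is
the derivative - 1 of the first factor.  Since that factor is zero at tau, no
cut-off in time is needed. *)
Lemma transport_duality (g g' : R -> R) (tau : R) :
  (forall y : R, is_derive y 1 g (g' y)) -> continuous g' ->
  (forall y, `|g y| <= 1) ->
  tau \in `[0, T] -> (forall y, 1 - X tau <= y -> g y = 0) ->
  \int[mu]_(t in `[0, tau])
     (\int[mu]_(x in `[0, 1]) (rho t x * g (x - X t))) =
  \int[mu]_(t in `[0, tau]) (u t * ((tau - t) * g (- X t))) +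
  tau * (c * \int[mu]_(x in `[0, 1]) g x).
Proof.
move=> dg cg' g1 tauT gk.
have cg : continuous g.
  move=> y; apply: differentiable_continuous; apply/derivable1_diffP.
  exact: ex_derive.
move: (tauT); rewrite in_itv/= => /andP[tau0 tauleT].
pose phi (t x : R) := (tau - t) * g (x - X t).
pose phi_x (t x : R) := (tau - t) * g' (x - X t).
pose phi_t (t x : R) := - g (x - X t) - (tau - t) * g' (x - X t) * v t.
have [hL1 /(_ tau phi phi_t phi_x tauT)] := hw.
case: (hL1) => irho _.
have cgX (h : R -> R) : continuous h -> forall z : R * R, 0 <= z.1 ->
    {for z, continuous (fun z : R * R => h (z.2 - X z.1))}.
  move=> ch z z1; apply: (@continuous_comp _ _ _ (fun z => z.2 - X z.1) h);
    last exact: ch.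
  apply: continuousB; first exact: cvg_snd.
  by apply: (@continuous_comp _ _ _ fst X); [exact: cvg_fst|exact: cX].
have ctau (z : R * R) : {for z, continuous (fun z : R * R => tau - z.1)}.
  by apply: continuousB; [exact: cst_continuous|exact: cvg_fst].
have Qge (z : R * R) : z \in `[0, tau] `*` `[0, 1] -> 0 <= z.1.
  by rewrite inE => -[]/=; rewrite in_itv/= => /andP[].
have C1 : C1_on_rectangle tau phi phi_t phi_x.
  split.
  + apply: continuous_in_subspaceT => z /Qge z1.
    by apply: cvgM; [exact: (ctau z)|exact: (cgX _ _ z z1)].
  + apply: continuous_in_subspaceT => z /Qge z1; apply: cvgB.
      by apply: cvgN; exact: (cgX _ _ z z1).
    apply: cvgM; last first.
      by apply: (@continuous_comp _ _ _ fst v); [exact: cvg_fst|exact: cv].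
    by apply: cvgM; [exact: (ctau z)|exact: (cgX _ _ z z1)].
  + apply: continuous_in_subspaceT => z /Qge z1.
    by apply: cvgM; [exact: (ctau z)|exact: (cgX _ _ z z1)].
  + move=> t x; rewrite in_itv/= => /andP[t0 _] _.
    have dXt : is_derive t 1 X (v t).
      by apply: dX; apply: lt_trans t0; rewrite ltrN10.
    have dgt := dg (x - X t).
    split.
      have d1 : is_derive t 1 (cst x - X) (0 - v t) by exact: is_deriveB.
      have d2 : is_derive t 1 (g \o (cst x - X)) (g' (x - X t) * (0 - v t)).
        exact: is_derive1_comp.
      have d3 : is_derive t 1 (cst tau - id) (0 - 1) by exact: is_deriveB.
      apply: (is_derive_eq (is_deriveM d3 d2)).
      by rewrite /phi_t /GRing.scale/= !fctE; ring.
    have d1 : is_derive x 1 (id - cst (X t)) (1 - 0) by exact: is_deriveB.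
    have d2 : is_derive x 1 (g \o (id - cst (X t))) (g' (x - X t) * (1 - 0)).
      exact: is_derive1_comp.
    apply: (is_derive_eq (is_deriveM (is_derive_cst (tau - t) x 1) d2)).
    by rewrite /phi_x /GRing.scale/= !fctE; ring.
have phitau x : x \in `[0, 1] -> phi tau x = 0.
  by move=> _; rewrite /phi subrr mul0r.
have phi1 t : t \in `[0, tau] -> phi t 1 = 0.
  rewrite in_itv/= => /andP[t0 tt]; rewrite /phi gk ?mulr0//.
  by rewrite lerB// leX.
move=> /(_ C1 phitau phi1).
set M := fun t => \int[mu]_(x in `[0, 1]) (rho t x * g (x - X t)).
have sub : `[0, tau] `<=` (`[0, T] : set R).
  by apply: subset_itvl; rewrite bnd_simp.
have iM : mu.-integrable `[0, tau] (EFin \o M).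
  apply: continuous_compact_integrable; first exact: segment_compact.
  apply: continuous_subspaceW sub _.
  apply: continuous_moving_average => // t; rewrite in_itv/= => /andP[t0 _].
  exact: cX.
have inner t : t \in (`[0, tau]%classic : set R) ->
    \int[mu]_(x in `[0, 1])
      (rho t x * (phi_t t x + lam (total_mass rho t) * phi_x t x)) = -1 * M t.
  rewrite inE => /sub tT; rewrite /M -RintegralZl//; last first.
    apply: (integrable_mulr_bounded (C := 1)) => //; first exact: irho.
    apply: measurable_funTS; apply: continuous_measurable_fun => x.
    apply: continuous_comp; last exact: cg.
    by apply: continuousB; [exact: cvg_id|exact: cst_continuous].
  apply: eq_Rintegral => x _; rewrite -vE// /phi_t /phi_x; ring.
under eq_Rintegral => t tt do rewrite inner//.
rewrite (@RintegralZl _ _ _ mu _ M (-1))//.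
rewrite [X in _ + _ + X](_ : _ =
    tau * (c * \int[mu]_(x in `[0, 1]) g x)); last first.
  rewrite mulrA -RintegralZl//; last first.
    apply: continuous_compact_integrable; first exact: segment_compact.
    exact: continuous_subspaceT.
  by apply: eq_Rintegral => x _; rewrite /phi X0 !subr0; ring.
rewrite [X in _ + X + _](_ : _ =
    \int[mu]_(t in `[0, tau]) (u t * ((tau - t) * g (- X t)))); last first.
  by apply: eq_Rintegral => t _; rewrite /phi sub0r.
by lra.
Qed.

Let subT (tau : R) : tau <= T -> `[0, tau] `<=` (`[0, T] : set R).
Proof. by move=> tT; apply: subset_itvl; rewrite bnd_simp. Qed.

Let wcX (tau : R) : {within `[0, tau], continuous X}.
Proof. exact: (curve_within_continuous dX). Qed.

Let measurable_flux (g : R -> R) (tau : R) : measurable_fun setT g ->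
  measurable_fun `[0, tau] (fun t => g (- X t)).
Proof.
move=> mg; apply: (measurable_comp measurableT) => //.
apply: measurable_funN; apply: subspace_continuous_measurable_fun => //.
Qed.

(** By [transport_duality] the time integral from 0 to s of the left-hand side is
the second primitive at s of u t * g (- X t), plus a linear term.  Formally the
claim is the derivative of this in s; u being merely integrable, the derivative
at tau is obtained by comparison with the increments on (s, tau). *)
Lemma pointwise_duality (g g' : R -> R) (tau : R) :
  (forall y : R, is_derive y 1 g (g' y)) -> continuous g' ->
  (forall y, 0 <= g y <= 1) -> 0 < tau -> tau <= T ->
  (forall y, 1 - X tau <= y -> g y = 0) ->
  \int[mu]_(x in `[0, 1]) (rho tau x * g (x - X tau)) =
  \int[mu]_(t in `[0, tau]) (u t * g (- X t)) +
  c * \int[mu]_(x in `[0, 1]) g x.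
Proof.
move=> dg cg' g01 tau0 tauT gk.
have g0 y : 0 <= g y by have /andP[] := g01 y.
have g1 y : `|g y| <= 1 by rewrite ger0_norm//; have /andP[] := g01 y.
have cg : continuous g.
  move=> y; apply: differentiable_continuous; apply/derivable1_diffP.
  exact: ex_derive.
pose w t := u t * g (- X t).
have wi : mu.-integrable `[0, tau] (EFin \o w).
  apply: (integrable_mulr_bounded (C := 1)) => //.
    by apply: integrableS ui => //; exact: subT.
  apply: measurable_flux; apply: continuous_measurable_fun; exact: cg.
have w0 t : 0 <= w t by rewrite mulr_ge0.
pose M t := \int[mu]_(x in `[0, 1]) (rho t x * g (x - X t)).
pose C := c * \int[mu]_(x in `[0, 1]) g x.
pose J s := \int[mu]_(t in `[0, s]) w t + C.
have cM : {within `[0, tau], continuous M}.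
  apply: continuous_subspaceW (subT tauT) _.
  case: hw => hL _; apply: continuous_moving_average => // t.
  rewrite in_itv/= => /andP[t0 _].
  exact: cX.
have cJ : {within `[0, tau], continuous J}.
  move=> s; apply: cvgD; last exact: cvg_cst.
  exact: (parameterized_integral_continuous (ltW tau0) wi).
apply: (left_average_squeeze tau0 cM cJ) => s s0 st.
have E r : 0 <= r -> r <= tau -> \int[mu]_(t in `[0, r]) M t =
    \int[mu]_(t in `[0, r]) (w t * (r - t)) + r * C.
  move=> r0 rt; rewrite (transport_duality dg cg')//.
  - by congr (_ + _); apply: eq_Rintegral => t _; rewrite /w; ring.
  - by rewrite in_itv/= r0 (le_trans rt).
  - move=> y yr; apply: gk; apply: le_trans yr.
    by rewrite lerB// leX.
have /andP[lo up] := weighted_integral_bounds s0 (ltW st) wi w0.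
have := Rintegral_itv_split s0 (ltW st)
  (continuous_compact_integrable (@segment_compact _ _ _) cM).
rewrite (E tau (ltW tau0) (lexx _)) (E s s0 (ltW st)).
move: lo up; rewrite /J; set Ptau := \int[mu]_(t in `[0, tau]) (w t * _).
set Ps := \int[mu]_(t in `[0, s]) (w t * _).
set Q := \int[mu]_(x in `]s, tau]) M x => lo up S.
have -> : Q = Ptau - Ps + (tau - s) * C by rewrite mulrBl; lra.
by rewrite !mulrDr !lerD2r lo up.
Qed.

(** What lies to the left of k at time tau is either initial matter, displaced by
X tau, or entered at a time t such that the distance travelled since then,
X tau - X t, is less than k.  The restriction k <= 1 reflects that the state is
tested only with functions that vanish at the outflow. *)
Lemma cumulative_mass (tau k : R) : 0 < tau -> tau <= T -> k <= 1 ->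
  \int[mu]_(x in `[0, 1]) (rho tau x * (x < k)%R%:R) =
  \int[mu]_(t in `[0, tau]) (u t * (X tau - X t < k)%R%:R) +
  c * Num.max 0 (k - X tau).
Proof.
move=> tau0 tauT k1.
have Xtau : 0 < X tau by rewrite -X0 (curve_lt v0 dX).
pose h := smooth_step (k - X tau); pose eps n : R := n.+1%:R^-1.
have eps0 n : 0 < eps n by rewrite invr_gt0.
have h1 n y : `|h (eps n) y| <= 1.
  by have /andP[? ?] := smooth_step_itv (k - X tau) y (eps0 n); rewrite ger0_norm.
have mh n : measurable_fun setT (h (eps n)).
  apply: continuous_measurable_fun => y; apply: differentiable_continuous.
  apply/derivable1_diffP.
  have dh := is_derive_smooth_step (k - X tau) y (eps0 n); exact: ex_derive.
have hcvg y : h (eps n) y @[n --> \oo] --> ((y < k - X tau)%R%:R : R).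
  exact: cvg_smooth_step.
have tau_in : tau \in `[0, T] by rewrite in_itv/= ltW.
have iu : mu.-integrable `[0, tau] (EFin \o u).
  by apply: integrableS ui => //; exact: subT.
(* The smoothing is removed in each of the three terms of the duality. *)
have lim1 : \int[mu]_(x in `[0, 1]) (rho tau x * h (eps n) (x - X tau))
    @[n --> \oo] --> \int[mu]_(x in `[0, 1]) (rho tau x * (x < k)%R%:R).
  apply: cvg_Rintegral_mulr => //.
  - by have [[+ _] _] := hw; apply.
  - move=> n; apply: measurable_funTS.
    apply: measurableT_comp => //.
    by apply: measurable_funB; [exact: measurable_id|exact: measurable_cst].
  - move=> x _; rewrite (_ : (x < k) = (x - X tau < k - X tau)); last first.
      by rewrite ltrD2r.
    exact: hcvg.
have lim2 : \int[mu]_(t in `[0, tau]) (u t * h (eps n) (- X t))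
    @[n --> \oo] -->
    \int[mu]_(t in `[0, tau]) (u t * (X tau - X t < k)%R%:R).
  apply: cvg_Rintegral_mulr => //.
  - by move=> n; exact: measurable_flux.
  - move=> t _; rewrite (_ : (_ < k) = (- X t < k - X tau)); last first.
      by rewrite ltrBrDl.
    exact: hcvg.
have lim3 : c * \int[mu]_(x in `[0, 1]) h (eps n) x @[n --> \oo] -->
    c * Num.max 0 (k - X tau).
  apply: cvgM; first exact: cvg_cst.
  rewrite -(@Rintegral_ltr _ (k - X tau)); last first.
    by rewrite lerBlDr (le_trans k1)// lerDl ltW.
  have : \int[mu]_(x in `[0, 1]) (1 * h (eps n) x) @[n --> \oo] -->
      \int[mu]_(x in `[0, 1]) (1 * (x < k - X tau)%R%:R).
    apply: cvg_Rintegral_mulr => //.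
    - apply: continuous_compact_integrable; first exact: segment_compact.
      by apply: continuous_subspaceT; exact: cst_continuous.
    - by move=> n; exact: measurable_funTS.
  under eq_Rintegral do rewrite mul1r.
  apply: cvg_trans; apply: near_eq_cvg; apply: nearW => n.
  by apply: eq_Rintegral => x _; rewrite mul1r.
apply: (cvg_unique (@Rhausdorff R) lim1).
have pw n : \int[mu]_(x in `[0, 1]) (rho tau x * h (eps n) (x - X tau)) =
    \int[mu]_(t in `[0, tau]) (u t * h (eps n) (- X t)) +
    c * \int[mu]_(x in `[0, 1]) h (eps n) x.
  apply: (pointwise_duality (fun y => is_derive_smooth_step _ y (eps0 n))) => //.
  - exact: continuous_dsmooth_step.
  - by move=> y; exact: smooth_step_itv.
  - move=> y yk; apply: smooth_step_eq0 => //.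
    by rewrite (le_trans _ yk)// lerB.
rewrite /= (funext pw).
exact: cvgD.
Qed.

End characteristics.

(** * The lower bound *)

Section lower_bound.
Context {R : realType}.
Local Notation mu := (@lebesgue_measure R).

(** An influx that is nonnegative almost everywhere may be assumed nonnegative
everywhere. *)
Lemma weak_solution_normr (lam : R -> R) (T : R) (r u : R -> R)
    (rho : R -> R -> R) : admissible_influx u ->
  weak_solution lam T r u rho ->
  weak_solution lam T r (fun t => `|u t|) rho.
Proof.
move=> [ui u0] [rhoc H]; split=> // tau phi phi_t phi_x tauT C1 z1 z2.
transitivity (\int[mu]_(t in `[0, tau])
       (\int[mu]_(x in `[0, 1])
          (rho t x * (phi_t t x + lam (total_mass rho t) * phi_x t x)))
    + \int[mu]_(t in `[0, tau]) (u t * phi t 0)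
    + \int[mu]_(x in `[0, 1]) (r x * phi 0 x)); last exact: H.
congr (_ + _ + _).
have sub : `[0, tau] `<=` (`[0, +oo[ : set R) by apply: subset_itvl.
have mu_u : measurable_fun `[0, tau] u.
  have /integrableP[/measurable_EFinP + _] := ui.
  exact: measurable_funS.
have mphi : measurable_fun `[0, tau] (phi ^~ 0).
  apply: subspace_continuous_measurable_fun => //.
  case: C1 => c1 _ _ _.
  apply: (@continuous_within_comp _ _ _ _ _ _ (fun t : R => (t, 0)) c1).
    apply: continuous_subspaceT => t.
    by apply: (@cvg_pair _ _ _ (nbhs t) (nbhs t) (nbhs (0 : R)) _ _ _ id (cst 0));
      [exact: cvg_id|exact: cvg_cst].
  by move=> t tt; split => //=; rewrite in_itv/= lexx ler01.
apply: ae_eq_Rintegral => //.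
- by apply: measurable_funM => //; exact: measurableT_comp.
- exact: measurable_funM.
- apply: (negligibleS _ u0) => t /= h h0; apply: h => tt.
  by rewrite ger0_norm// h0//; exact: sub.
Qed.

Variables (lam : R -> R) (rho0 rho1 : R).
Hypothesis hlam : velocity_extension lam.
Hypothesis h0 : 0 <= rho0.
Hypothesis h01 : rho0 < rho1.

(** The mass at each time before T is bounded below by the initial matter that
is still present plus the matter that has entered and is seen at time T; this
limits the speed and hence the distance that can be covered by time T. *)
Lemma transfer_time_ge (T : R) (u : R -> R) (rho : R -> R -> R) :
  0 < T -> mu.-integrable `[0, T] (EFin \o u) -> (forall t, 0 <= u t) ->
  weak_solution lam T (fun=> rho0) u rho ->
  {ae mu, forall x : R, x \in `]0, 1[ -> rho T x = rho1} ->
  1 + (rho0 + rho1) / 2 <= T.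
Proof.
move=> T0 ui u0 hw rhoT.
have rho10 : 0 < rho1 by exact: le_lt_trans h01.
have [dlam _ lam0 lamE] := hlam.
have clam : continuous lam.
  by move=> w; apply: differentiable_continuous; exact/derivable1_diffP.
have [hL1 _] := hw.
have irho := hL1.1.
pose W := total_mass rho.
have cW := continuous_total_mass hL1.
(* W is continuous only on the interval of existence; clamping the time makes
   the velocity continuous on the whole line, as the primitive X requires. *)
pose v t := lam (W (clamp 0 T t)).
have cv : continuous v.
  move=> t; apply: (@continuous_comp _ _ _ (W \o clamp 0 T) lam);
    last exact: clam.
  apply: (continuous_comp_within cW); first exact: continuous_clamp.
  by move=> z; exact: clamp_itv (ltW T0).
have v0 t : 0 < v t by exact: lam0.
have vE t : t \in `[0, T] -> v t = lam (total_mass rho t).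
  by move=> tT; rewrite /v clamp_id.
have [X X0 dX] := antiderivative cv.
have wcX (e f : R) : 0 <= e -> {within `[e, f], continuous X}.
  by move=> e0; exact: (curve_within_continuous dX e0).
have ltX (s t : R) : 0 <= s -> s < t -> X s < X t by exact: (curve_lt v0 dX).
have leX (s t : R) : 0 <= s -> s <= t -> X s <= X t by exact: (curve_le v0 dX).
have cumul := cumulative_mass hw ui u0 cv v0 vE X0 dX.
have iuk (tau r k : R) : 0 <= tau -> tau <= T ->
    mu.-integrable `[0, tau] (EFin \o (fun t => u t * (r - X t < k)%R%:R)).
  move=> tau0 tauT; apply: integrable_mulr_bool => //.
    by apply: integrableS ui => //; apply: subset_itvl; rewrite bnd_simp.
  apply: measurable_fun_ltr => //.
  apply: measurable_funB; first exact: measurable_cst.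
  by apply: subspace_continuous_measurable_fun => //; exact: wcX.
(* The total mass: the case k = 1 of the cumulative formula. *)
have mass (tau : R) : 0 < tau -> tau <= T -> W tau =
    \int[mu]_(t in `[0, tau]) (u t * (X tau - X t < 1)%R%:R) +
    rho0 * Num.max 0 (1 - X tau).
  move=> tau0 tauT; rewrite -cumul//.
  have irt : mu.-integrable `[0, 1] (EFin \o rho tau).
    by apply: irho; rewrite in_itv/= ltW.
  apply: ae_eq_Rintegral => //.
  - exact: measurable_fun_integrable.
  - by apply: measurable_fun_integrable; apply: integrable_mulr_bool => //;
      exact: measurable_fun_ltr.
  - apply: ae_itv_oo_cc; apply: aeW => x; rewrite in_itv/= => /andP[_ ->].
    by rewrite mulr1.
(* The same formula at the final time, where the state is rho1. *)
have final (k : R) : k <= 1 -> rho1 * Num.max 0 k =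
    \int[mu]_(t in `[0, T]) (u t * (X T - X t < k)%R%:R) +
    rho0 * Num.max 0 (k - X T).
  move=> k1; rewrite -cumul// -Rintegral_ltr//.
  have i1 (r : R) :
      mu.-integrable `[0, 1] (EFin \o (fun x => r * (x < k)%R%:R)).
    apply: (@integrable_mulr_bool _ _ (fun=> r)) => //.
      exact: (@integrable_cst_itv _ _ _ 0 1).
    exact: measurable_fun_ltr.
  rewrite -RintegralZl//; last first.
    rewrite (_ : _ \o _ = EFin \o (fun x : R => 1 * (x < k)%R%:R)).
      exact: i1.
    by apply/funext => x; rewrite /= mul1r.
  have irt : mu.-integrable `[0, 1] (EFin \o rho T).
    by apply: irho; rewrite in_itv/= lexx ltW.
  apply: ae_eq_Rintegral => //.
  - exact: measurable_fun_integrable.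
  - by apply: measurable_fun_integrable; apply: integrable_mulr_bool => //;
      exact: measurable_fun_ltr.
  - apply: ae_itv_oo_cc; apply: (negligibleS _ rhoT) => x /= h h'.
    by apply: h => x01; rewrite h'.
pose a := X T - 1.
have XT0 : 0 < X T by rewrite -X0 ltX.
(* Otherwise the formulas of the final state for k = 1 and for k between X T
   and 1 both involve the whole influx; their difference equates the final and
   the initial mass of (k, 1). *)
have a0 : 0 <= a.
  rewrite subr_ge0 leNgt; apply/negP => XT1.
  have U (k : R) : X T < k ->
      \int[mu]_(t in `[0, T]) (u t * (X T - X t < k)%R%:R) =
      \int[mu]_(t in `[0, T]) u t.
    move=> XTk; apply: eq_Rintegral => t; rewrite inE/= in_itv/= => /andP[t0 _].
    rewrite (_ : _ < k) ?mulr1// (le_lt_trans _ XTk)// lerBlDr lerDl.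
    by rewrite -X0 leX.
  pose k := (1 + X T) / 2.
  have k1 : k < 1 by rewrite /k; lra.
  have XTk : X T < k by rewrite /k; lra.
  have := final 1 (lexx _); have := final k (ltW k1); rewrite !U//.
  rewrite !max_r ?subr_ge0 ?ltW//; last exact: lt_trans XTk.
  move=> e1 e2.
  have : (rho1 - rho0) * (1 - k) = 0 by lra.
  by apply/eqP; rewrite mulf_neq0// subr_eq0 gt_eqF.
have Wlow (tau : R) : 0 < tau -> tau < T ->
    rho0 * Num.max 0 (1 - X tau) + rho1 * Num.max 0 (X tau - a) <= W tau.
  move=> tau0 tauT; rewrite mass ?(ltW tauT)// addrC lerD2r.
  have i0 : 0 <= \int[mu]_(t in `[0, tau]) (u t * (X tau - X t < 1)%R%:R).
    by apply: Rintegral_ge0 => t _; rewrite mulr_ge0.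
  have [|aX] := leP (X tau - a) 0; first by rewrite mulr0.
  (* At time T, what entered after tau fills (0, b); what is seen in (b, 1)
     entered before tau and is still in the interval at time tau. *)
  pose b := X T - X tau.
  have b0 : 0 < b by rewrite subr_gt0 ltX// ltW.
  have b1 : b < 1 by move: aX; rewrite /a /b; lra.
  have := final 1 (lexx _); have := final b (ltW b1).
  rewrite !(Rintegral_itv_split (ltW tau0) (ltW tauT)); last 2 first.
    exact: iuk (ltW T0) (lexx _).
    exact: iuk (ltW T0) (lexx _).
  have -> : \int[mu]_(t in `[0, tau]) (u t * (X T - X t < b)%R%:R) = 0.
    transitivity (\int[mu]_(t in `[0, tau]) 0); last first.
      by rewrite Rintegral_cst// mul0r.
    apply: eq_Rintegral => t; rewrite inE/= in_itv/= => /andP[t0 tt].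
    by rewrite ltrD2l ltrN2 ltNge leX// mulr0.
  have late (k : R) : b <= k ->
      \int[mu]_(t in `]tau, T]) (u t * (X T - X t < k)%R%:R) =
      \int[mu]_(t in `]tau, T]) u t.
    move=> bk; apply: eq_Rintegral => t; rewrite inE/= in_itv/= => /andP[tt _].
    rewrite (_ : _ < k) ?mulr1// (lt_le_trans _ bk)// ltrD2l ltrN2.
    by rewrite ltX// ltW.
  rewrite !late ?(ltW b1)//.
  have up : \int[mu]_(t in `[0, tau]) (u t * (X T - X t < 1)%R%:R) <=
      \int[mu]_(t in `[0, tau]) (u t * (X tau - X t < 1)%R%:R).
    apply: le_Rintegral => //.
    - exact: iuk (ltW tau0) (ltW tauT).
    - exact: iuk (ltW tau0) (ltW tauT).
    - move=> t _; rewrite ler_wpM2l//.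
      have [tb|_] := ltP (X T - X t) 1; last exact: ler0n.
      by rewrite (le_lt_trans _ tb)// lerD2r leX// ltW.
  move=> e1 e2; apply: le_trans up.
  have z1 : Num.max 0 (1 - X T) = 0 by rewrite max_l//; move: a0; rewrite /a; lra.
  have z2 : Num.max 0 (b - X T) = 0 by rewrite max_l//; move: a0; rewrite /a; lra.
  move: e1 e2; rewrite z1 z2 (max_r (ltW b0)) (max_r ler01) /a /b; lra.
(* Up to a constant, Psi is the primitive of 1 + rho0 (1-y)^+ + rho1 (y-a)^+. *)
pose Psi (y : R) := y - rho0 / 2 * possq (1 - y) + rho1 / 2 * possq (y - a).
pose dPsi (y : R) := 1 + rho0 * Num.max 0 (1 - y) + rho1 * Num.max 0 (y - a).
have dPsiE (y : R) : is_derive y 1 Psi (dPsi y).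
  have d1 : is_derive y 1 (cst 1 - id) (0 - 1) by exact: is_deriveB.
  have p1 := is_derive_possq (1 - y).
  have d2 : is_derive y 1 (possq \o (cst 1 - id))
    (2 * Num.max 0 (1 - y) * (0 - 1)) by exact: is_derive1_comp.
  have d3 : is_derive y 1 (id - cst a) (1 - 0) by exact: is_deriveB.
  have p2 := is_derive_possq (y - a).
  have d4 : is_derive y 1 (possq \o (id - cst a))
    (2 * Num.max 0 (y - a) * (1 - 0)) by exact: is_derive1_comp.
  have d5 := is_deriveB (is_derive_id y 1)
    (is_deriveM (is_derive_cst (rho0 / 2) y 1) d2).
  have d6 := is_deriveD d5 (is_deriveM (is_derive_cst (rho1 / 2) y 1) d4).
  apply: (is_derive_eq d6); rewrite /dPsi /GRing.scale/= !fctE; lra.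
have cPsi : continuous Psi.
  move=> w; apply: differentiable_continuous; apply/derivable1_diffP.
  have dPw := dPsiE w; exact: ex_derive.
have [z|z|s] := @MVT R (Psi \o X) (fun t => dPsi (X t) * v t) 0 T T0.
- rewrite in_itv/= => /andP[z0 _].
  have dXz : is_derive z 1 X (v z) by apply: dX; rewrite (lt_trans _ z0)// ltrN10.
  exact: is_derive1_comp.
- apply: (@continuous_within_comp _ _ _ _ setT).
  + exact: continuous_subspaceT.
  + exact: wcX.
  + by [].
rewrite in_itv/= => /andP[s0 sT]; rewrite subr0 => e.
have Ws := Wlow s s0 sT.
have Ws0 : 0 <= W s.
  apply: le_trans Ws; rewrite addr_ge0// mulr_ge0 ?le_max ?lexx// ltW//.
have dle : dPsi (X s) * v s <= 1.
  have sT' : s \in `[0, T] by rewrite in_itv/= (ltW s0) ltW.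
  rewrite vE// -/W lamE// mul1r ler_pdivrMr ?ltr_pwDl// mul1r.
  by rewrite /dPsi -addrA lerD2l.
have : Psi (X T) - Psi (X 0) <= T.
  have -> : Psi (X T) - Psi (X 0) = (dPsi (X s) * v s) * T by exact: e.
  by rewrite ler_piMl// ltW.
have p1 : possq (1 : R) = 1 by rewrite /possq max_r ?ler01// expr1n.
have e1 : possq (1 - X T) = 0 by apply: possq_eq0; rewrite -oppr_ge0 opprB.
have e2 : possq (X T - a) = 1 by rewrite (_ : X T - a = 1)// /a; ring.
have e3 : possq (0 - a) = 0 by apply: possq_eq0; rewrite sub0r oppr_le0.
rewrite X0 /Psi e1 e2 e3 subr0 p1; move: a0; rewrite /a; lra.
Qed.

End lower_bound.

(** * A control attaining the bound *)

Section ramp.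
Context {R : realType}.
Local Notation mu := (@lebesgue_measure R).
Variables rho0 rho1 : R.
Hypothesis h0 : 0 <= rho0.
Hypothesis h01 : rho0 < rho1.

Let d := rho1 - rho0.
Let b := 1 + rho0.

Let d0 : 0 < d. Proof. by rewrite subr_gt0. Qed.
Let b0 : 0 < b. Proof. by rewrite ltr_wpDr. Qed.

(** The time at which the front arrives at x.  Its derivative in x is 1 + W with
W = rho0 + (rho1 - rho0) x, the mass when the front is at x. *)
Definition entry_time (x : R) := (1 + rho0) * x + (rho1 - rho0) / 2 * x ^+ 2.

(** The inverse of [entry_time] for nonnegative arguments: the position of the
front at time t. *)
Definition front (t : R) :=
  (Num.sqrt ((1 + rho0) ^+ 2 + 2 * (rho1 - rho0) * t) - (1 + rho0)) /
    (rho1 - rho0).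

Local Notation eta := entry_time.
Local Notation xi := front.

Lemma front_ge0 t : 0 <= t -> 0 <= xi t.
Proof.
move=> t0; rewrite /front -/b -/d divr_ge0 ?(ltW d0)// subr_ge0.
apply: (@le_trans _ _ (Num.sqrt (b ^+ 2))); first by rewrite sqrtr_sqr ler_norm.
by rewrite ler_wsqrtr// lerDl mulr_ge0// mulr_ge0// ltW.
Qed.

Lemma entry_front t : 0 <= t -> eta (xi t) = t.
Proof.
move=> t0; rewrite /entry_time /front -/b -/d.
set s := Num.sqrt _.
have s2 : s ^+ 2 = b ^+ 2 + 2 * d * t.
  by rewrite sqr_sqrtr// addr_ge0 ?sqr_ge0// mulr_ge0// mulr_ge0// ltW.
have dn : d != 0 by rewrite gt_eqF.
have -> : b * ((s - b) / d) + d / 2 * ((s - b) / d) ^+ 2 =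
    (s ^+ 2 - b ^+ 2) / (2 * d) by field.
by rewrite s2; field.
Qed.

Lemma entry_le x y : 0 <= x -> 0 <= y -> (eta x <= eta y) = (x <= y).
Proof.
move=> x0 y0; rewrite -subr_ge0 -[RHS]subr_ge0.
have -> : eta y - eta x = (b + d / 2 * (x + y)) * (y - x).
  by rewrite /entry_time -/b -/d; ring.
by rewrite pmulr_rge0// ltr_pwDl// mulr_ge0 ?addr_ge0// divr_ge0// ltW.
Qed.

Lemma entry_ge0 x : 0 <= x -> 0 <= eta x.
Proof.
by move=> x0; rewrite /entry_time addr_ge0// mulr_ge0 ?sqr_ge0 ?(ltW b0)//
  divr_ge0 ?(ltW d0).
Qed.

Lemma entry_le_front t x : 0 <= t -> 0 <= x -> (eta x <= t) = (x <= xi t).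
Proof.
by move=> t0 x0; rewrite -{1}(entry_front t0) entry_le// front_ge0.
Qed.

Lemma front_entry x : 0 <= x -> xi (eta x) = x.
Proof.
move=> x0.
have e0 := entry_ge0 x0.
apply/eqP; rewrite eq_le.
rewrite -(entry_le_front e0 x0) lexx andbT -entry_le ?front_ge0//.
by rewrite entry_front.
Qed.

Lemma continuous_front : continuous xi.
Proof.
move=> t; rewrite /front; apply: cvgM; last exact: cvg_cst.
apply: cvgB; last exact: cvg_cst.
apply: (@continuous_comp _ _ _ (fun t => b ^+ 2 + 2 * d * t) Num.sqrt);
  last exact: sqrt_continuous.
apply: cvgD; first exact: cvg_cst.
by apply: cvgM; [exact: cvg_cst|exact: cvg_id].
Qed.

Lemma is_derive_entry (x : R) : is_derive x 1 eta (b + d * x).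
Proof.
have d1 := is_derive_id x 1.
have d2 := is_deriveD (is_deriveM (is_derive_cst b x 1) d1)
  (is_deriveM (is_derive_cst (d / 2) x 1) (is_deriveM d1 d1)).
by apply: (is_derive_eq d2); rewrite /GRing.scale/= !fctE; lra.
Qed.

Lemma continuous_entry : continuous eta.
Proof.
move=> x; have dx := is_derive_entry x.
by apply: differentiable_continuous; apply/derivable1_diffP; exact: ex_derive.
Qed.

(** Density rho1 behind the front and rho0 ahead of it.  Comparing times rather
than positions keeps the sections in t explicit; [ramp_front] gives those in
x. *)
Definition ramp (t x : R) := rho0 + (rho1 - rho0) * (eta x <= t)%R%:R.

Let Tm := 1 + (rho0 + rho1) / 2.

Lemma entry_time1 : eta 1 = Tm.
Proof. by rewrite /entry_time /Tm; field. Qed.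

Lemma front_le1 t : 0 <= t -> t <= Tm -> xi t <= 1.
Proof.
move=> t0 tT; rewrite -entry_le ?front_ge0// entry_time1 entry_front//.
Qed.

Lemma ramp_front t x : 0 <= t -> 0 <= x ->
  ramp t x = rho0 + (rho1 - rho0) * (x <= xi t)%R%:R.
Proof. by move=> t0 x0; rewrite /ramp entry_le_front. Qed.

Let int_step (g : R -> R) (r z : R) : continuous g ->
  mu.-integrable `[0, 1] (EFin \o (fun x => r * (g x <= z)%R%:R)).
Proof.
move=> cg; apply: (@integrable_mulr_bool _ _ (fun=> r)) => //.
  exact: (@integrable_cst_itv _ _ _ 0 1).
apply: measurable_fun_ler => //; apply: measurable_funTS.
exact: continuous_measurable_fun cg.
Qed.

Let Rint_step (r z : R) : 0 <= z -> z <= 1 ->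
  \int[mu]_(x in `[0, 1]) (r * (x <= z)%R%:R) = r * z.
Proof.
move=> z0 z1; rewrite (@Rintegral_mulr_le _ _ _ _ (fun=> r))//.
rewrite Rintegral_cst//= lebesgue_measure_itv/= lte_fin.
by case: ltgtP z0 => //= [_ _|<- _]; rewrite ?subr0 ?mulr0.
Qed.

Lemma integrable_ramp t : 0 <= t -> mu.-integrable `[0, 1] (EFin \o ramp t).
Proof.
move=> t0; apply: integrable_addr => //.
  exact: (@integrable_cst_itv _ _ _ 0 1).
by apply: int_step; exact: continuous_entry.
Qed.

Lemma total_mass_ramp t : 0 <= t -> t <= Tm ->
  total_mass ramp t = rho0 + (rho1 - rho0) * xi t.
Proof.
move=> t0 tT; rewrite /total_mass.
transitivity (\int[mu]_(x in `[0, 1]) (rho0 + d * (x <= xi t)%R%:R)).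
  by apply: eq_Rintegral => x; rewrite inE/= in_itv/= => /andP[x0 _]; rewrite ramp_front.
rewrite RintegralD//; last 2 first.
- exact: (@integrable_cst_itv _ _ _ 0 1).
- by apply: int_step => x; exact: cvg_id.
rewrite Rint_step ?front_ge0 ?front_le1//; congr (_ + _).
by rewrite Rintegral_cst//= lebesgue_measure_itv/= lte_fin ltr01 oppr0 addr0 mulr1.
Qed.

Lemma continuous_in_L1_ramp : continuous_in_L1 Tm ramp.
Proof.
split=> [t|t]; rewrite in_itv/= => /andP[t0 tT]; first exact: integrable_ramp.
(* The two states differ by rho1 - rho0 between the two fronts. *)
have key s : 0 <= s -> s <= Tm ->
    \int[mu]_(x in `[0, 1]) `|ramp s x - ramp t x| = d * `|xi s - xi t|.
  move=> s0 sT.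
  transitivity (\int[mu]_(x in `[0, 1]) (d * (x <= Num.max (xi s) (xi t))%R%:R -
      d * (x <= Num.min (xi s) (xi t))%R%:R)).
    apply: eq_Rintegral => x; rewrite inE/= in_itv/= => /andP[x0 _].
    rewrite !ramp_front// -/d -mulrBr opprD addrACA subrr add0r -mulrBr.
    rewrite normrM gtr0_norm//; congr (_ * _).
    rewrite le_max le_min.
    by case: (x <= xi s); case: (x <= xi t) => /=;
      rewrite ?subrr ?subr0 ?sub0r ?normrN ?normr1 ?normr0.
  have ii z : mu.-integrable `[0, 1] (EFin \o (fun x => d * (x <= z)%R%:R)).
    by apply: int_step => x; exact: cvg_id.
  rewrite RintegralB// !Rint_step; last 4 first.
  - by rewrite le_min !front_ge0.
  - by rewrite ge_min front_le1.
  - by rewrite le_max front_ge0.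
  - by rewrite ge_max !front_le1.
  rewrite -mulrBr; congr (_ * _).
  by case: (leP (xi s) (xi t)) => h; [rewrite ler0_norm ?subr_le0// opprB|
    rewrite gtr0_norm ?subr_gt0].
apply/cvgrPdist_le => e e0.
have /cvgrPdist_le/(_ (d^-1 * e)) : xi s @[s --> within `[0, Tm] (nbhs t)] --> xi t.
  by apply: cvg_within_filter; exact: continuous_front.
rewrite mulr_gt0 ?invr_gt0// => /(_ isT) H; near=> s.
have : s \in `[0, Tm] by near: s; exact: withinT.
rewrite in_itv/= => /andP[s0 sT].
rewrite key// sub0r normrN ger0_norm; last by rewrite mulr_ge0// ltW.
by rewrite -ler_pdivlMl// distrC; near: s.
Unshelve. all: by end_near. Qed.

End ramp.

Section ramp_solution.
Context {R : realType}.
Local Notation mu := (@lebesgue_measure R).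
Variables rho0 rho1 : R.
Hypothesis h0 : 0 <= rho0.
Hypothesis h01 : rho0 < rho1.
Variable lam : R -> R.
Hypothesis hlam : velocity_extension lam.

Let d := rho1 - rho0.
Let b := 1 + rho0.

Let d0 : 0 < d. Proof. by rewrite subr_gt0. Qed.
Let b0 : 0 < b. Proof. by rewrite ltr_wpDr. Qed.
Let Tm := 1 + (rho0 + rho1) / 2.
Local Notation eta := (entry_time rho0 rho1).
Local Notation xi := (front rho0 rho1).
Local Notation rho := (ramp rho0 rho1).

Definition speed (t : R) := 1 / (1 + rho0 + (rho1 - rho0) * xi t).

Let xi0 (t : R) : 0 <= t -> 0 <= xi t. Proof. exact: front_ge0. Qed.

Let den0 t : 0 <= t -> 0 < b + d * xi t.
Proof. by move=> t0; rewrite ltr_pwDl// mulr_ge0 ?xi0// ltW. Qed.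

Lemma speedE t : 0 <= t -> t <= Tm -> lam (total_mass rho t) = speed t.
Proof.
move=> t0 tT; rewrite total_mass_ramp//.
have [_ _ _ lamE] := hlam; rewrite lamE ?addrA//.
by rewrite addr_ge0// mulr_ge0 ?xi0// ltW.
Qed.

Lemma within_continuous_speed tau : {within `[0, tau], continuous speed}.
Proof.
apply: continuous_in_subspaceT => t; rewrite inE/= in_itv/= => /andP[t0 _].
apply: cvgM; first exact: cvg_cst.
apply: cvgV; first by rewrite gt_eqF// den0.
apply: cvgD; first exact: cvg_cst.
by apply: cvgM; [exact: cvg_cst|exact: continuous_front].
Qed.

(** The flux at which the entering density is rho1, stopped at the final time so
that it is integrable on the half-line. *)
Definition inflow (t : R) :=
  if (0 <= t <= 1 + (rho0 + rho1) / 2) then rho1 * speed t else 0.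

(** The substitution t = eta x, where speed (eta x) is the reciprocal of
the derivative of eta at x. *)
Lemma front_flux (tau : R) (g : R -> R) : 0 <= tau ->
  {within `[0, tau], continuous g} ->
  \int[mu]_(t in `[0, tau]) (speed t * g t) =
  \int[mu]_(x in `[0, xi tau]) g (eta x).
Proof.
move=> tau0 cg.
have z0 := xi0 tau0.
have eta0 : eta 0 = 0 by rewrite /entry_time expr0n/= !mulr0 addr0.
have d1 x : derive1 eta x = b + d * x.
  have dx := is_derive_entry rho0 rho1 x.
  by rewrite derive1E derive_val.
have cd1 : continuous (derive1 eta).
  rewrite (funext d1) => x; apply: cvgD; first exact: cvg_cst.
  by apply: cvgM; [exact: cvg_cst|exact: cvg_id].
pose G t := speed t * g t.
have cG : {within `[0, tau], continuous G}.
  by move=> t; apply: cvgM; [exact: within_continuous_speed|exact: cg].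
have := @integration_by_substitution_increasing R eta G 0 (xi tau) z0.
rewrite eta0 entry_front// => H.
rewrite /Rintegral H//.
- congr fine; apply: eq_integral => x; rewrite inE/= in_itv/= => /andP[x0 xz].
  congr EFin; change (G (eta x) * derive1 eta x = g (eta x)).
  rewrite d1 /G /speed front_entry// -/b -/d.
  rewrite div1r mulrAC mulVf ?mul1r// gt_eqF// ltr_pwDl// mulr_ge0 ?(ltW d0)//.
- move=> x y; rewrite !in_itv/= => /andP[x0 _] /andP[y0 _].
  by rewrite !ltNge entry_le.
- apply/cvg_ex; exists (derive1 eta 0); apply: cvg_at_right_filter; exact: cd1.
- apply/cvg_ex; exists (derive1 eta (xi tau)); apply: cvg_at_left_filter; exact: cd1.
- split.
  + by move=> x _; have dx := is_derive_entry rho0 rho1 x; exact: ex_derive.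
  + by apply: cvg_at_right_filter; exact: continuous_entry.
  + by apply: cvg_at_left_filter; exact: continuous_entry.
Qed.

Lemma measurable_ramp : measurable_fun setT (fun z : R * R => rho z.1 z.2).
Proof.
apply: measurable_funD; first exact: measurable_cst.
apply: measurable_funM; first exact: measurable_cst.
rewrite (_ : (fun _ => _) =
  fun z : R * R => if eta z.2 <= z.1 then 1 : R else 0); last first.
  by apply/funext => z; case: (eta _ <= _).
apply: measurable_fun_ifT => //; apply: measurable_fun_ler => //.
apply: measurableT_comp => //; exact: continuous_measurable_fun (@continuous_entry _ _ _).
Qed.

Lemma ramp_itv t x : 0 <= rho t x <= rho1.
Proof.
rewrite /ramp; case: (eta x <= t).
  by rewrite mulr1 subrKC lexx andbT ltW// (le_lt_trans h0).
by rewrite mulr0 addr0 h0 ltW.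
Qed.

Section identity.
Variables (tau : R) (phi phi_t phi_x : R -> R -> R).
Hypothesis tau0 : 0 < tau.
Hypothesis tauT : tau <= Tm.
Hypothesis C1 : C1_on_rectangle tau phi phi_t phi_x.
Hypothesis phitau : forall x : R, x \in `[0, 1] -> phi tau x = 0.
Hypothesis phi1 : forall t : R, t \in `[0, tau] -> phi t 1 = 0.

Let cphi := let: And4 c _ _ _ := C1 in c.
Let cphi_t := let: And4 _ c _ _ := C1 in c.
Let cphi_x := let: And4 _ _ c _ := C1 in c.
Let dphi := let: And4 _ _ _ c := C1 in c.

Let ccst (r s e : R) : {within `[r, s], continuous (fun=> e : R)}.
Proof. by apply: continuous_subspaceT; exact: cst_continuous. Qed.

Let cid (r s : R) : {within `[r, s], continuous (fun t => t : R)}.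
Proof. by apply: continuous_subspaceT => t; exact: cvg_id. Qed.

Let row (f : R -> R -> R) (t : R) :
  {within `[0, tau] `*` `[0, 1], continuous (fun z : R * R => f z.1 z.2)} ->
  t \in `[0, tau] -> {within `[0, 1], continuous (f t)}.
Proof.
move=> cf tt.
exact: (@within_continuous_path _ tau 0 1 _ (fun=> t) id cf (@ccst 0 1 t) (@cid 0 1)).
Qed.

Let col (f : R -> R -> R) (x : R) :
  {within `[0, tau] `*` `[0, 1], continuous (fun z : R * R => f z.1 z.2)} ->
  x \in `[0, 1] -> {within `[0, tau], continuous (f ^~ x)}.
Proof.
move=> cf xx.
exact: (@within_continuous_path _ tau 0 tau _ id (fun=> x) cf (@cid 0 tau) (@ccst 0 tau x)).
Qed.

Let slice_t (x s : R) : x \in `]0, 1[ -> 0 <= s -> s <= tau ->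
  \int[mu]_(t in `[s, tau]) phi_t t x = - phi s x.
Proof.
move=> x01 s0 st.
have x01' : x \in `[0, 1] by exact: subset_itv_oo_cc x01.
have sub : `[s, tau] `<=` (`[0, tau] : set R).
  by apply: subset_itvr; rewrite bnd_simp.
transitivity (phi tau x - phi s x); last by rewrite phitau// sub0r.
apply: (@Rintegral_derivative _ (phi_t ^~ x) (phi ^~ x)) => //.
- by apply: continuous_subspaceW sub _; exact: col.
- by apply: continuous_subspaceW sub _; exact: col.
- move=> t; rewrite in_itv/= => /andP[ts tt].
  by apply: (dphi _ x01).1; rewrite in_itv/= (le_lt_trans s0).
Qed.

Let slice_x (t z : R) : t \in `]0, tau[ -> 0 <= z -> z <= 1 ->
  \int[mu]_(x in `[0, z]) phi_x t x = phi t z - phi t 0.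
Proof.
move=> tt z0 z1.
have tt' : t \in `[0, tau] by exact: subset_itv_oo_cc tt.
have sub : `[0, z] `<=` (`[0, 1] : set R).
  by apply: subset_itvl; rewrite bnd_simp.
apply: (@Rintegral_derivative _ (phi_x t) (phi t)) => //.
- by apply: continuous_subspaceW sub _; exact: row.
- by apply: continuous_subspaceW sub _; exact: row.
- move=> x; rewrite in_itv/= => /andP[x0 xz].
  by apply: (dphi tt _).2; rewrite in_itv/= x0 (lt_le_trans xz).
Qed.

Let unit_ge0 (x : R) : x \in `[0, 1] -> 0 <= x.
Proof. by rewrite in_itv/= => /andP[]. Qed.

Let front_itv (t : R) : t \in `[0, tau] -> xi t \in `[0, 1].
Proof.
rewrite !in_itv/= => /andP[t0 tt]; rewrite xi0//= front_le1//.
exact: le_trans tauT.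
Qed.

Let integrable_ramp_mul (f : R -> R -> R) (t : R) :
  {within `[0, tau] `*` `[0, 1], continuous (fun z : R * R => f z.1 z.2)} ->
  t \in `[0, tau] -> mu.-integrable `[0, 1] (EFin \o (fun x => rho t x * f t x)).
Proof.
move=> cf tt; have cft := row cf tt.
have [C HC] := bounded_within_compact (@segment_compact _ 0 1) cft.
apply: (@integrable_mulr_bounded _ _ C) => //; last exact: measurable_within.
by apply: integrable_ramp => //; move: tt; rewrite in_itv/= => /andP[].
Qed.

(* The integrand rho f, with f extended from the rectangle to the plane. *)
Let ext (f : R -> R -> R) (z : R * R) :=
  rho z.1 z.2 * f (clamp 0 tau z.1) (clamp 0 1 z.2).

Let extE (f : R -> R -> R) (t x : R) : t \in `[0, tau] -> x \in `[0, 1] ->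
  ext f (t, x) = rho t x * f t x.
Proof. by move=> tt xx; rewrite /ext/= !clamp_id. Qed.

Let ext_measurable (f : R -> R -> R) :
  {within `[0, tau] `*` `[0, 1], continuous (fun z : R * R => f z.1 z.2)} ->
  measurable_fun setT (ext f).
Proof.
move=> cf; apply: measurable_funM; first exact: measurable_ramp.
apply: continuous_measurable_prod.
apply: (continuous_comp_within (r := fun z => (clamp 0 tau z.1, clamp 0 1 z.2)) cf).
  move=> z; apply: (@cvg_pair _ _ _ (nbhs z) (nbhs (clamp 0 tau z.1))
    (nbhs (clamp 0 1 z.2)) _ _ _ (clamp 0 tau \o fst) (clamp 0 1 \o snd)).
    by apply: continuous_comp; [exact: cvg_fst|exact: continuous_clamp].
  by apply: continuous_comp; [exact: cvg_snd|exact: continuous_clamp].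
by move=> z; split => /=; [exact: clamp_itv (ltW tau0)|exact: clamp_itv ler01].
Qed.

Let ext_bounded (f : R -> R -> R) :
  {within `[0, tau] `*` `[0, 1], continuous (fun z : R * R => f z.1 z.2)} ->
  exists C, forall z, `|ext f z| <= C.
Proof.
move=> cf.
have cQ : compact (`[0, tau]%classic `*` `[0, 1]%classic : set (R * R)).
  by apply: compact_setX; exact: segment_compact.
have [C HC] := bounded_within_compact cQ cf.
exists (rho1 * C) => z; rewrite /ext normrM.
have /andP[r0 r1] := ramp_itv z.1 z.2.
rewrite ler_pM// ?(ger0_norm r0)//; apply: (HC (_, _)).
by split => /=; [exact: clamp_itv (ltW tau0)|exact: clamp_itv ler01].
Qed.

Let row_ext (f : R -> R -> R) (t : R) : t \in `[0, tau] ->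
  \int[mu]_(x in `[0, 1]) ext f (t, x) = \int[mu]_(x in `[0, 1]) (rho t x * f t x).
Proof. by move=> tt; apply: eq_Rintegral => x; rewrite inE => xx; rewrite extE. Qed.

(* The flux term integrated in space: the jump rho1 - rho0 at the front, and the
   influx at the boundary. *)
Let flux_row (t : R) : t \in `]0, tau[ ->
  \int[mu]_(x in `[0, 1]) (rho t x * phi_x t x) =
  d * phi t (xi t) - rho1 * phi t 0.
Proof.
move=> tt; have tt' : t \in `[0, tau] by exact: subset_itv_oo_cc tt.
have t0 : 0 <= t by move: tt'; rewrite in_itv/= => /andP[].
have /andP[z0 z1] : 0 <= xi t <= 1 by have := front_itv tt'; rewrite in_itv.
have iphi := integrable_within (row cphi_x tt').
have istep : mu.-integrable `[0, 1] (EFin \o (fun x => phi_x t x * (x <= xi t)%R%:R)).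
  by apply: integrable_mulr_bool => //; exact: measurable_fun_ler.
transitivity (\int[mu]_(x in `[0, 1])
    (rho0 * phi_x t x + d * (phi_x t x * (x <= xi t)%R%:R))).
  apply: eq_Rintegral => x; rewrite inE => /unit_ge0 x0.
  by rewrite ramp_front// -/d; ring.
rewrite RintegralD//; [|exact: integrable_mull|exact: integrable_mull].
rewrite !RintegralZl// Rintegral_mulr_le// !slice_x// phi1//.
by rewrite /d; ring.
Qed.

(* The phi_t term integrated in time: the initial value, and the jump at the
   time at which the front passes x.  The clamping matters only for the points
   that the front has not yet reached, where the last factor is zero. *)
Let entry_col (x : R) : x \in `]0, 1[ ->
  \int[mu]_(t in `[0, tau]) (rho t x * phi_t t x) =
  -1 * (rho0 * phi 0 x) +
  - d * (phi (clamp 0 tau (eta x)) x * (x <= xi tau)%R%:R).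
Proof.
move=> xx; have xx' : x \in `[0, 1] by exact: subset_itv_oo_cc xx.
have x0 := unit_ge0 xx'.
have iphi := integrable_within (col cphi_t xx').
have istep : mu.-integrable `[0, tau]
    (EFin \o (fun t => phi_t t x * (eta x <= t)%R%:R)).
  by apply: integrable_mulr_bool => //; exact: measurable_fun_ler.
transitivity (\int[mu]_(t in `[0, tau])
    (rho0 * phi_t t x + d * (phi_t t x * (eta x <= t)%R%:R))).
  by apply: eq_Rintegral => t _; rewrite /ramp -/d; ring.
rewrite RintegralD//; [|exact: integrable_mull|exact: integrable_mull].
rewrite !RintegralZl//.
rewrite Rintegral_mulr_ge ?entry_ge0// (slice_t xx (lexx 0) (ltW tau0)).
rewrite -entry_le_front ?(ltW tau0)//.
have [etau|taue] := leP (eta x) tau.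
  rewrite slice_t ?entry_ge0// clamp_id ?in_itv/= ?entry_ge0//; ring.
rewrite set_itv_ge ?bnd_simp -?ltNge// Rintegral_set0 /= !mulr0 !addr0; ring.
Qed.

(** The phi_t term is integrated first in t, after an exchange of the order of
integration, and the phi_x term first in x.  Apart from boundary data, which
match the influx and initial terms, each leaves (rho1 - rho0) times the
integral of phi along the front, once over positions and once over times, with
opposite signs. *)
Lemma ramp_weak_identity :
  \int[mu]_(t in `[0, tau])
     (\int[mu]_(x in `[0, 1])
        (rho t x * (phi_t t x + lam (total_mass rho t) * phi_x t x)))
  + \int[mu]_(t in `[0, tau]) (inflow t * phi t 0)
  + \int[mu]_(x in `[0, 1]) (rho0 * phi 0 x) = 0.
Proof.
have [Ct HCt] := ext_bounded cphi_t.
have [Cx HCx] := ext_bounded cphi_x.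
have mt := ext_measurable cphi_t.
have mx := ext_measurable cphi_x.
pose P t := \int[mu]_(x in `[0, 1]) ext phi_t (t, x).
pose S t := \int[mu]_(x in `[0, 1]) ext phi_x (t, x).
have iP : mu.-integrable `[0, tau] (EFin \o P) by exact: integrable_row_integral HCt.
have iS : mu.-integrable `[0, tau] (EFin \o S) by exact: integrable_row_integral HCx.
have cspeed := @within_continuous_speed tau.
have [Cs HCs] := bounded_within_compact (@segment_compact _ 0 tau) cspeed.
have iSs : mu.-integrable `[0, tau] (EFin \o (fun t => S t * speed t)).
  by apply: (@integrable_mulr_bounded _ _ Cs) => //; exact: measurable_within.
have z00 : (0 : R) \in `[0, 1] by rewrite in_itv/= lexx ler01.
have cphi0 := col cphi z00.
have cphixi : {within `[0, tau], continuous (fun t => phi t (xi t))}.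
  apply: (@within_continuous_path _ tau 0 tau _ id xi cphi (@cid 0 tau)).
    by apply: continuous_subspaceT; exact: continuous_front.
  by move=> t tt; split => //; exact: front_itv.
have inner : \int[mu]_(t in `[0, tau])
     (\int[mu]_(x in `[0, 1])
        (rho t x * (phi_t t x + lam (total_mass rho t) * phi_x t x))) =
    \int[mu]_(t in `[0, tau]) P t + \int[mu]_(t in `[0, tau]) (S t * speed t).
  rewrite -RintegralD//; apply: eq_Rintegral => t; rewrite inE => tt.
  have [t0 tt'] : 0 <= t /\ t <= Tm.
    by move: (tt); rewrite /= in_itv/= => /andP[? ?]; split => //; exact: le_trans tauT.
  rewrite /P /S !row_ext// -RintegralZr//; last exact: integrable_ramp_mul.
  rewrite -RintegralD//; last 2 first.
  - exact: integrable_ramp_mul.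
  - rewrite (_ : (fun _ => _) = fun x => speed t * (rho t x * phi_x t x)).
      by apply: integrable_mull => //; exact: integrable_ramp_mul.
    by apply/funext => x; rewrite mulrC.
  by apply: eq_Rintegral => x _; rewrite speedE//; ring.
have outP : \int[mu]_(t in `[0, tau]) P t =
    -1 * \int[mu]_(x in `[0, 1]) (rho0 * phi 0 x) +
    - d * \int[mu]_(x in `[0, xi tau]) phi (clamp 0 tau (eta x)) x.
  have tau00 : 0 \in `[0, tau] by rewrite in_itv/= lexx ltW.
  have i0 : mu.-integrable `[0, 1] (EFin \o (fun x => rho0 * phi 0 x)).
    by apply: integrable_mull => //; apply: integrable_within; exact: row.
  have ck : {within `[0, 1], continuous (fun x => phi (clamp 0 tau (eta x)) x)}.
    apply: (@within_continuous_path _ tau 0 1 _ (clamp 0 tau \o eta) id cphi _ (@cid 0 1)).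
      apply: continuous_subspaceT => x.
      by apply: continuous_comp; [exact: continuous_entry|exact: continuous_clamp].
    by move=> x xx; split => //; exact: clamp_itv (ltW tau0).
  have ik : mu.-integrable `[0, 1]
      (EFin \o (fun x => phi (clamp 0 tau (eta x)) x * (x <= xi tau)%R%:R)).
    apply: integrable_mulr_bool => //; first exact: integrable_within.
    exact: measurable_fun_ler.
  have /andP[z0 z1] : 0 <= xi tau <= 1.
    have tt : tau \in `[0, tau] by rewrite in_itv/= lexx ltW.
    by have := front_itv tt; rewrite in_itv.
  rewrite /P (fubini_rectangle tau 1 mt HCt) -(@Rintegral_mulr_le _ 0 1 (xi tau))//.
  rewrite -!RintegralZl// -RintegralD//; [|exact: integrable_mull..].
  apply: ae_eq_Rintegral => //.
  - exact: measurable_col_integral HCt.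
  - apply: measurable_fun_integrable; apply: integrable_addr => //;
      exact: integrable_mull.
  - apply: ae_itv_oo_cc; apply: aeW => x xx; rewrite -entry_col//.
    apply: eq_Rintegral => t; rewrite inE => tt; rewrite extE//.
    exact: subset_itv_oo_cc xx.
have outS : \int[mu]_(t in `[0, tau]) (S t * speed t) =
    d * \int[mu]_(t in `[0, tau]) (speed t * phi t (xi t)) -
    \int[mu]_(t in `[0, tau]) (inflow t * phi t 0).
  have i1 : mu.-integrable `[0, tau] (EFin \o (fun t => speed t * phi t (xi t))).
    by apply: integrable_within => t; apply: cvgM; [exact: cspeed|exact: cphixi].
  have i2 : mu.-integrable `[0, tau] (EFin \o (fun t => speed t * phi t 0)).
    by apply: integrable_within => t; apply: cvgM; [exact: cspeed|exact: cphi0].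
  have -> : \int[mu]_(t in `[0, tau]) (inflow t * phi t 0) =
      rho1 * \int[mu]_(t in `[0, tau]) (speed t * phi t 0).
    rewrite -RintegralZl//; apply: eq_Rintegral => t.
    rewrite inE/= in_itv/= /inflow => /andP[-> tt].
    have -> : t <= 1 + (rho0 + rho1) / 2 by exact: le_trans tauT.
    by rewrite /= -mulrA.
  rewrite -!RintegralZl// -RintegralB//; [|exact: integrable_mull..].
  apply: ae_eq_Rintegral => //.
  - exact: measurable_fun_integrable.
  - apply: measurable_fun_integrable; apply: integrable_subr => //;
      exact: integrable_mull.
  - apply: ae_itv_oo_cc; apply: aeW => t tt.
    rewrite /S row_ext; last exact: subset_itv_oo_cc tt.
    by rewrite flux_row//; ring.
have subst := front_flux (ltW tau0) cphixi.
have substE : \int[mu]_(x in `[0, xi tau]) phi (eta x) (xi (eta x)) =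
    \int[mu]_(x in `[0, xi tau]) phi (clamp 0 tau (eta x)) x.
  apply: eq_Rintegral => x; rewrite inE/= in_itv/= => /andP[x0 xz].
  by rewrite front_entry// clamp_id// in_itv/= entry_ge0//= entry_le_front// ltW.
rewrite inner outP outS subst substE; ring.
Qed.

End identity.
End ramp_solution.

Section optimum.
Context {R : realType}.
Local Notation mu := (@lebesgue_measure R).
Variables (lam : R -> R) (rho0 rho1 : R).
Hypothesis hlam : velocity_extension lam.
Hypothesis h0 : 0 <= rho0.
Hypothesis h01 : rho0 < rho1.

Let Tm := 1 + (rho0 + rho1) / 2.

Let rho1_gt0 : 0 < rho1. Proof. exact: le_lt_trans h01. Qed.

Lemma admissible_inflow : admissible_influx (inflow rho0 rho1).
Proof.
split; last first.
  apply: aeW => t _; rewrite /inflow; case: ifP => // /andP[t0 _].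
  rewrite mulr_ge0 ?(ltW rho1_gt0)// /speed divr_ge0// addr_ge0//.
    by rewrite addr_ge0.
  by rewrite mulr_ge0 ?subr_ge0 ?(ltW h01)// front_ge0.
pose g (t : R) := rho1 * speed rho0 rho1 t.
have -> : inflow rho0 rho1 = g \_ `[0, Tm].
  apply/funext => t; rewrite /inflow patchE.
  have [t0|t0] := boolP (0 <= t <= _); first by rewrite mem_set//= in_itv.
  by rewrite memNset//= in_itv/=; exact/negP.
have ig : mu.-integrable `[0, Tm] (EFin \o g).
  apply: integrable_mull => //; apply: integrable_within.
  exact: within_continuous_speed.
apply: (@integrableS _ _ _ mu setT) => //.
have [+ _] := @integrable_mkcond _ _ _ mu `[0, Tm]%classic (EFin \o g) (measurable_itv _).
by rewrite restrict_EFin; exact.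
Qed.

Lemma weak_solution_ramp :
  weak_solution lam Tm (fun=> rho0) (inflow rho0 rho1) (ramp rho0 rho1).
Proof.
split; first exact: continuous_in_L1_ramp.
move=> tau phi phi_t phi_x; rewrite in_itv/= => /andP[tau0 tauT] C1 z1 z2.
move: tau0; rewrite le_eqVlt => /predU1P[tau0|tau0]; last first.
  exact: (ramp_weak_identity h0 h01 hlam tau0 tauT C1 z1 z2).
rewrite -tau0 in z1 z2 *; rewrite !set_itv1 !Rintegral_set1 !add0r.
transitivity (\int[mu]_(x in `[0, 1]) (0 : R)).
  by apply: eq_Rintegral => x; rewrite inE => xx; rewrite z1// mulr0.
by rewrite Rintegral_cst// mul0r.
Qed.

Lemma ramp_final (x : R) : 0 <= x -> x <= 1 -> ramp rho0 rho1 Tm x = rho1.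
Proof.
move=> x0 x1; rewrite /ramp -[Tm](entry_time1 rho0 rho1) entry_le// x1.
by rewrite mulr1 subrKC.
Qed.

End optimum.

Theorem proposition4p1 (R : realType) (lam : R -> R) (rho0 rho1 : R)
    (hlam : velocity_extension lam) (h0 : 0 <= rho0) (h01 : rho0 < rho1) :
  is_minimum (transfer_times lam rho0 rho1) (1 + (rho0 + rho1) / 2).
Proof.
split.
- split; first by rewrite ltr_pwDl// divr_ge0// addr_ge0// ltW// (le_lt_trans h0).
  exists (inflow rho0 rho1); split; first exact: admissible_inflow.
  exists (ramp rho0 rho1); split; first exact: weak_solution_ramp.
  apply: aeW => x; rewrite in_itv/= => /andP[x0 x1].
  by rewrite ramp_final// ltW.
- move=> T [T0 [u [hu [rho [hw rhoT]]]]].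
  have hw' := weak_solution_normr hu hw.
  apply: (transfer_time_ge hlam h0 h01 T0 _ _ hw') => //.
  apply: integrable_normr; case: hu => ui _.
  by apply: integrableS ui => //; exact: subset_itvl.
Qed.
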